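(* Let $\{x_k\}$ be generated by the algorithm RDSE-DD described in the context, with associated directions $\{d_k\}$. If $\{x_{i(k)}\}$ is a refining subsequence with $x_{i(k)}\to x^*\in\mathcal M$, then $x^*$ is Clarke stationary for $f$.
   Context: Setting. $\mathcal M$ is a smooth manifold embedded in $\mathbb R^n$, equipped with a Riemannian metric $\langle\cdot,\cdot\rangle_x$ on $T_x\mathcal M$ depending smoothly on $x$, with norm $\|\cdot\|_x$. $\operatorname{dist}(x,y)$ is the length of the shortest geodesic connecting $x,y\in\mathcal M$; $\Gamma_x^y:T_x\mathcal M\to T_y\mathcal M$ is parallel transport with respect to the Levi-Civita connection along a (fixed) shortest geodesic from $x$ to $y$, the same geodesic reversed being used for $\Gamma_y^x$. For $v\in T_x\mathcal M$, $w\in T_y\mathcal M$, $\operatorname{dist}^*(v,w)=\|v-\Gamma_y^xw\|_x=\|w-\Gamma_x^yv\|_y$. For $v_k\in T_{y_k}\mathcal M$ and $v\in T_y\mathcal M$, $v_k\to v$ means $y_k\to y$ and $\operatorname{dist}^*(v_k,v)\to0$. $\mathsf P_x$ is the orthogonal projection from $\mathbb R^n$ onto $T_x\mathcal M$, and $S(0,1)$ is the unit sphere of $\mathbb R^n$. Assumptions. $f:\mathcal M\to\mathbb R$ is Lipschitz continuous and bounded below. $R\in C^1(T\mathcal M,\mathcal M)$ is a retraction ($R(x,0)=x$ and the differential of $R(x,\cdot)$ at $0$ is the identity of $T_x\mathcal M$) and there is $L_r>0$ with $\operatorname{dist}(R(x,d),x)\le L_r\|d\|_x$ for all $(x,d)\in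 T\mathcal M$. Clarke stationarity. For a chart $(\varphi,U)$ at $x$ and $v\in T_x\mathcal M$, with $\tilde f=f\circ\varphi^{-1}$, the Clarke directional derivative is $f^\circ(x,v)=\tilde f^\circ(\varphi(x),d\varphi(x)v)$, where for locally Lipschitz $h$ on an open subset of $\mathbb R^m$, $h^\circ(y,w)=\limsup_{z\to y,\ t\downarrow0}\frac{h(z+tw)-h(z)}{t}$. A point $x^*$ is Clarke stationary if $f^\circ(x^*,d)\ge0$ for every $d\in T_{x^*}\mathcal M$. Refining subsequence. Given a sequence $(x_k,d_k)$ in $T\mathcal M$, the subsequence $\{x_{i(k)}\}$ is refining if $x_{i(k)}\to x$ for some $x\in\mathcal M$ and, for every $d\in T_x\mathcal M$ with $\|d\|_x=1$, there is a further subsequence $\{j(i(k))\}$ of the indices with $d_{j(i(k))}\to d$. Linesearch procedure LS$(\alpha,x,d,\gamma,\gamma_1,\gamma_2)$, for $\alpha>0$, $x\in\mathcal M$, $d\in T_x\mathcal M$: if $f(R(x,\alpha d))>f(x)-\gamma\alpha^2$, return $(0,\gamma_1\alpha)$. Otherwise, while $f(R(x,\alpha d))\le f(x)-\gamma\alpha^2$, replace $\alpha$ by $\gamma_2\alpha$; when the loop ends return $(\alpha/\gamma_2,\alpha/\gamma_2)$. Algorithm RDSE-DD. Input: $x_0\in\mathcal M$, $\tilde\alpha_0>0$, $\gamma>0$, $\gamma_1\in(0,1)$, $\gamma_2\ge1$, and a sequence $\{\bar d_k\}$ dense in $S(0,1)$. For $k=0,1,2,\dots$: let $d_k=\mathsf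 P_{x_k}(\bar d_k)/\|\mathsf P_{x_k}(\bar d_k)\|_{x_k}$ if $\mathsf P_{x_k}(\bar d_k)\ne0$ and $d_k=0$ otherwise; set $(\alpha_k,\tilde\alpha_{k+1})=\mathrm{LS}(\tilde\alpha_k,x_k,d_k,\gamma,\gamma_1,\gamma_2)$; set $x_{k+1}=R(x_k,\alpha_kd_k)$. That the algorithm generates $\{x_k\}$ presupposes that every call of LS terminates. *)

(* Defs.v *)
From mathcomp Require Import all_boot all_order all_algebra.
From mathcomp Require Import all_classical all_reals all_analysis.

Set Implicit Arguments.
Unset Strict Implicit.
Unset Printing Implicit Defensive.

Import Order.TTheory GRing.Theory Num.Theory.
Import numFieldNormedType.Exports.

Local Open Scope classical_set_scope.
Local Open Scope ring_scope.

Section Smoothness.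
Context {R : realType} {V W : normedModType R}.

Fixpoint Ck (k : nat) (U : set V) (F : V -> W) : Prop :=
  match k with
  | 0 => forall x, U x -> {for x, continuous F}
  | k'.+1 => (forall x, U x -> differentiable F x) /\
             forall v, Ck k' U (fun x => 'D_v F x)
  end.

Definition smooth_on (U : set V) (F : V -> W) := forall k, Ck k U F.

End Smoothness.

Section EmbeddedManifold.
Context {R : realType} {n : nat} (m : nat).
Implicit Types (M : set 'rV[R]_n) (x v w : 'rV[R]_n) (c : R -> 'rV[R]_n).

(* The library norm on row vectors is the sup norm, hence the explicit
   Euclidean inner product. *)
Definition dot v w : R := \sum_(i < n) v 0 i * w 0 i.

(* A chart (phi, U) of M: the domain is M `&` cdom, phi is cmap, and cinv is
   phi^-1.  A homeomorphism onto an open set of R^m whose inverse is a smooth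
   immersion into R^n is the same as a smooth chart of the embedded
   submanifold M. *)
Record chart M := Chart {
  cdom : set 'rV[R]_n;
  cmap : 'rV[R]_n -> 'rV[R]_m;
  cinv : 'rV[R]_m -> 'rV[R]_n;
  cdom_open : open cdom;
  crange_open : open (cmap @` (M `&` cdom));
  cmapK : forall x, (M `&` cdom) x -> cinv (cmap x) = x;
  cmap_continuous : {within M `&` cdom, continuous cmap};
  cinv_smooth : smooth_on (cmap @` (M `&` cdom)) cinv;
  cinv_immersion : forall u, (cmap @` (M `&` cdom)) u ->
    injective ('d cinv u : 'rV[R]_m -> 'rV[R]_n)
}.

Definition crange M (C : chart M) : set 'rV[R]_m := cmap C @` (M `&` cdom C).

Definition embedded_submanifold M :=
  forall x, M x -> exists C : chart M, cdom C x.

Definition tangent M x : set 'rV[R]_n := [set v | exists c (e : R),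
  [/\ 0 < e, forall t, ball (0 : R) e t -> M (c t),
      smooth_on (ball (0 : R) e) c, c 0 = x & derive1 c 0 = v]].

(* d phi(x) : T_x M -> R^m, the inverse of d(phi^-1)(phi x). *)
Definition dchart M (C : chart M) x v : 'rV[R]_m :=
  xget 0 [set a | 'd (cinv C) (cmap C x) a = v].

(* Orthogonal projection of v onto T_x M. *)
Definition tproj M x v : 'rV[R]_n :=
  xget 0 [set p | tangent M x p /\
                  forall w, tangent M x w -> dot (v - p) w = 0].

Definition unit_sphere : set 'rV[R]_n := [set v | dot v v = 1].

Section Metric.
Context (M : set 'rV[R]_n) (g : 'rV[R]_n -> 'rV[R]_n -> 'rV[R]_n -> R).

Definition gram (C : chart M) (u : 'rV[R]_m) : 'M[R]_m :=
  \matrix_(i, j) g (cinv C u) ('d (cinv C) u (delta_mx 0 i))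
                              ('d (cinv C) u (delta_mx 0 j)).

Definition riemannian_metric :=
  [/\ forall x v w, M x -> tangent M x v -> tangent M x w ->
        g x v w = g x w v,
      forall x (a : R) v w z, M x -> tangent M x v -> tangent M x w ->
        tangent M x z -> g x (a *: v + w) z = a * g x v z + g x w z,
      forall x v, M x -> tangent M x v -> v != 0 -> 0 < g x v v
    & forall (C : chart M) i j,
        smooth_on (crange C) (fun u => gram C u i j)].

Definition rnorm x v : R := Num.sqrt (g x v v).

(* Christoffel symbols Gamma^k_ij of the Levi-Civita connection. *)
Definition christoffel (C : chart M) (u : 'rV[R]_m) (k i j : 'I_m) : R :=
  2^-1 * \sum_(l < m) invmx (gram C u) k l *
    ('D_(delta_mx 0 i) (fun u' => gram C u' j l) u
     + 'D_(delta_mx 0 j) (fun u' => gram C u' i l) u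
     - 'D_(delta_mx 0 l) (fun u' => gram C u' i j) u).

Definition coordV (C : chart M) c (V : R -> 'rV[R]_n) (t : R) : 'rV[R]_m :=
  dchart C (c t) (V t).

(* Coordinates in C of the Levi-Civita covariant derivative of V along c. *)
Definition cov_deriv (C : chart M) c (V : R -> 'rV[R]_n) (t : R) : 'rV[R]_m :=
  \row_k (derive1 (coordV C c V) t 0 k
    + \sum_(i < m) \sum_(j < m) christoffel C (cmap C (c t)) k i j
        * coordV C c (derive1 c) t 0 i * coordV C c V t 0 j).

Definition parallel_at (C : chart M) c (V : R -> 'rV[R]_n) (t : R) :=
  [/\ \forall s \near t, [/\ M (c s), cdom C (c s), derivable c s 1
                           & tangent M (c s) (V s)],
      derivable (coordV C c V) t 1
    & cov_deriv C c V t = 0].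

(* A curve [0, 1] -> M is represented by c : R -> R^n, with values in M also
   slightly beyond the endpoints, so that two-sided derivatives make sense on
   [0, 1]; parallel fields and geodesics always extend that far, and only
   the restriction to [0, 1] matters.  By tensoriality it makes no
   difference whether an equation is asked for in one chart around each c t or
   in all of them. *)
Definition parallel c (V : R -> 'rV[R]_n) :=
  forall t, 0 <= t <= 1 -> forall C : chart M, cdom C (c t) ->
    parallel_at C c V t.

Definition geodesic c :=
  forall t, 0 <= t <= 1 -> exists2 C : chart M, cdom C (c t) &
    parallel_at C c (derive1 c) t.

Definition geodesic_between c x y := [/\ geodesic c, c 0 = x & c 1 = y].

Definition curve_length c : R :=
  \int[lebesgue_measure]_(t in `[0%R, 1%R]) rnorm (c t) (derive1 c t).

Definition shortest_geodesic c x y :=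
  geodesic_between c x y /\
  forall c', geodesic_between c' x y -> curve_length c <= curve_length c'.

(* A choice, for all x and y in M, of a shortest geodesic from x to y, with
   sigma y x the reverse of sigma x y. *)
Definition shortest_geodesics (sigma : 'rV[R]_n -> 'rV[R]_n -> R -> 'rV[R]_n) :=
  (forall x y, M x -> M y -> shortest_geodesic (sigma x y) x y) /\
  (forall x y, M x -> M y -> forall t, 0 <= t <= 1 ->
     sigma y x t = sigma x y (1 - t)).

Section Distance.
Context (sigma : 'rV[R]_n -> 'rV[R]_n -> R -> 'rV[R]_n).

Definition dist x y : R := curve_length (sigma x y).

(* Gamma_x^y, along sigma x y. *)
Definition ptransport x y v : 'rV[R]_n :=
  xget 0 [set w | exists V, [/\ parallel (sigma x y) V, V 0 = v & V 1 = w]].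

(* For v in T_x M and w in T_y M; equal to |v - Gamma_y^x w|_x, Gamma_x^y being
   an isometry with inverse Gamma_y^x. *)
Definition dist_star x y v w : R := rnorm y (w - ptransport x y v).

Definition tm_cvg (y_ v_ : nat -> 'rV[R]_n) y v :=
  y_ k @[k --> \oo] --> y /\
  dist_star (y_ k) y (v_ k) v @[k --> \oo] --> (0 : R).

Definition lipschitz_on_manifold (f : 'rV[R]_n -> R) :=
  exists L : R, forall x y, M x -> M y -> `|f x - f y| <= L * dist x y.

Definition bounded_below_on_manifold (f : 'rV[R]_n -> R) :=
  exists b : R, forall x, M x -> b <= f x.

(* In the chart of TM induced by a chart C of M, with coordinates
   (u, a) |-> (cinv C u, 'd (cinv C) u a).  As M is embedded, being C^1 as a
   map into M is being C^1 as a map into R^n. *)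
Definition C1_on_tangent_bundle (Ret : 'rV[R]_n -> 'rV[R]_n -> 'rV[R]_n) :=
  forall C : chart M,
    Ck 1 [set p : 'rV[R]_m * 'rV[R]_m | crange C p.1]
       (fun p : 'rV[R]_m * 'rV[R]_m =>
          Ret (cinv C p.1) ('d (cinv C) (p.1) (p.2))).

Definition C1_retraction (Ret : 'rV[R]_n -> 'rV[R]_n -> 'rV[R]_n) :=
  [/\ forall x d, M x -> tangent M x d -> M (Ret x d),
      C1_on_tangent_bundle Ret,
      forall x, M x -> Ret x 0 = x
    & forall x (C : chart M), M x -> cdom C x -> forall a : 'rV[R]_m,
        'd (fun b : 'rV[R]_m => Ret x ('d (cinv C) (cmap C x) b)) 0 a
        = 'd (cinv C) (cmap C x) a].

Definition retraction_bounded (Ret : 'rV[R]_n -> 'rV[R]_n -> 'rV[R]_n) :=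
  exists2 Lr : R, 0 < Lr & forall x d, M x -> tangent M x d ->
    dist (Ret x d) x <= Lr * rnorm x d.

Definition refining (x d : nat -> 'rV[R]_n) (i : nat -> nat) (xs : 'rV[R]_n) :=
  [/\ {homo i : a b / (a < b)%N}, M xs,
      x (i k) @[k --> \oo] --> xs
    & forall v, tangent M xs v -> rnorm xs v = 1 ->
        exists2 j : nat -> nat, {homo j : a b / (a < b)%N} &
          tm_cvg (fun k => x (i (j k))) (fun k => d (i (j k))) xs v].

End Distance.

End Metric.

(* h^o(y, w), with h possibly taking junk values away from y. *)
Definition clarke (h : 'rV[R]_m -> R) (y w : 'rV[R]_m) : \bar R :=
  limf_esup (fun p : 'rV[R]_m * R =>
               ((h (p.1 + p.2 *: w) - h p.1) / p.2)%:E)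
            (filter_prod (nbhs y) (at_right (0 : R))).

Definition clarke_manifold M (C : chart M) (f : 'rV[R]_n -> R) x v : \bar R :=
  clarke (f \o cinv C) (cmap C x) (dchart C x v).

(* The derivative does not depend on the chart. *)
Definition clarke_stationary M (f : 'rV[R]_n -> R) x :=
  forall C : chart M, cdom C x -> forall v, tangent M x v ->
    (0 <= clarke_manifold C f x v)%E.

End EmbeddedManifold.

Section Algorithm.
Context {R : realType} {n : nat}.
Implicit Types (x d : 'rV[R]_n).

Section Linesearch.
Context (f : 'rV[R]_n -> R) (Ret : 'rV[R]_n -> 'rV[R]_n -> 'rV[R]_n).
Context (gamma gamma1 gamma2 : R) (x d : 'rV[R]_n).

(* [ls_loop a b]: started at a, the while loop terminates with value b. *)
Inductive ls_loop : R -> R -> Prop :=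
| ls_stop a : f x - gamma * a ^+ 2 < f (Ret x (a *: d)) -> ls_loop a a
| ls_next a b : f (Ret x (a *: d)) <= f x - gamma * a ^+ 2 ->
    ls_loop (gamma2 * a) b -> ls_loop a b.

(* [linesearch a r]: the call terminates and returns the pair r. *)
Inductive linesearch (a : R) : R * R -> Prop :=
| ls_fail : f x - gamma * a ^+ 2 < f (Ret x (a *: d)) ->
    linesearch a (0, gamma1 * a)
| ls_success b : f (Ret x (a *: d)) <= f x - gamma * a ^+ 2 ->
    ls_loop a b -> linesearch a (b / gamma2, b / gamma2).

End Linesearch.

(* x, d, alpha, alphat are the sequences produced by a run of RDSE-DD with
   input x 0, alphat 0, gamma, gamma1, gamma2, dbar. *)
Definition rdse_dd (M : set 'rV[R]_n)
    (g : 'rV[R]_n -> 'rV[R]_n -> 'rV[R]_n -> R) (f : 'rV[R]_n -> R)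
    (Ret : 'rV[R]_n -> 'rV[R]_n -> 'rV[R]_n) (gamma gamma1 gamma2 : R)
    (dbar x d : nat -> 'rV[R]_n) (alpha alphat : nat -> R) :=
  [/\ [/\ M (x 0%N), 0 < alphat 0%N, 0 < gamma, 0 < gamma1 < 1
        & 1 <= gamma2],
      (forall k, unit_sphere (dbar k)) /\ unit_sphere `<=` closure (range dbar),
      forall k, d k = (let p := tproj M (x k) (dbar k) in
                       if p == 0 then 0 else (rnorm g (x k) p)^-1 *: p),
      forall k, linesearch f Ret gamma gamma1 gamma2 (x k) (d k)
                  (alphat k) (alpha k, alphat k.+1)
    & forall k, x k.+1 = Ret (x k) (alpha k *: d k)].

End Algorithm.

(* Main.v *)
(* In a chart C at the limit point, write y_k and a_k for the coordinates of x_k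
   and d_k.  Sufficient decrease forces the stepsizes to 0, so every iteration
   provides some beta_k -> 0 with f(R(x_k, beta_k d_k)) > f(x_k) - gamma beta_k^2.
   The retraction is C^1 with identity differential at 0, so R(x_k, beta_k d_k)
   has coordinates y_k + beta_k a_k + o(beta_k); along a further subsequence a_k
   tends to the coordinates b of a prescribed unit tangent vector, and since f is
   Lipschitz in the chart, f(y_k + beta_k b) >= f(y_k) - o(beta_k).  These
   difference quotients bound the Clarke derivative from below.

   Two facts of Riemannian geometry are needed.  First, dist is locally bounded
   by a multiple of the coordinate distance: the geodesic boundary value problem
   is solved in the chart by a Picard iteration, and since geodesics have
   constant speed the length of the solution is its initial speed.  Second,
   convergence with respect to dist^* implies convergence of the coordinates: the
   shortest geodesic from x_k to the limit is short, hence stays in the chart,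
   and the coordinates of a parallel field along it are almost constant.  The
   existence of parallel transport is not needed: were there no parallel field
   along that geodesic, ptransport would take the junk value 0 and dist^* would
   be 1. *)

From HB Require Import structures.
Require Import Defs.
From mathcomp Require Import all_boot all_order all_algebra.
From mathcomp Require Import all_classical all_reals all_analysis.
From mathcomp Require Import ring lra.
Import Order.TTheory GRing.Theory Num.Theory.
Import numFieldNormedType.Exports.
Local Open Scope classical_set_scope.
Local Open Scope ring_scope.

Set Implicit Arguments.
Unset Strict Implicit.
Unset Printing Implicit Defensive.

(** * Differential calculus in coordinates *)

(** Base points move: the iterates approach the limit without being equal to it, so an expansion
    based at the limit point alone says nothing about them. The expansions of [Ret] and of [cinv]
    are therefore taken in strict form, uniform in nearby base points, and this is where C^1 enters.
    The differential of [cinv] can then be frozen at the limit, and its injectivity carries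
    estimates from R^n back to coordinates. The function [f] is Lipschitz for [dist], the length of
    a shortest geodesic. Shortest is meant among geodesics, so a straight segment in the chart is no
    competitor, and bounding [dist] takes a geodesic joining two given nearby points. A chart map is
    only continuous by definition; derivatives of the coordinates of a curve are recovered from the
    immersion [cinv]. Near the limit, the norm of the metric lies between [c1] and [c2] times the
    sup norm of the coordinates: [c2] bounds lengths from above, while [c1] turns the constant speed
    of a geodesic into a bound on its displacement in the chart. *)

Lemma near_ballP (R : realType) (V : normedModType R) (p : V) (P : V -> Prop) :
  (\forall x \near p, P x) <->
  exists2 e : R, 0 < e & forall x, `|x - p| < e -> P x.
Proof.
split=> [/nbhs_normP[e /= e0 He]|[e e0 He]].
  by exists e => // x xp; apply: He; rewrite /= distrC.
by apply/nbhs_normP; exists e => //= x; rewrite /= distrC; exact: He.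
Qed.

Lemma continuous_atP (R : realType) (V W : normedModType R) (F : V -> W) (p : V) :
  {for p, continuous F} <->
  forall e : R, 0 < e ->
    exists2 d, 0 < d & forall x, `|x - p| < d -> `|F x - F p| < e.
Proof.
split=> [/cvgrPdist_lt cF e e0|cF].
  have /near_ballP[d d0 Hd] := cF e e0.
  by exists d => // x /Hd; rewrite distrC.
apply/cvgrPdist_lt => e e0; apply/near_ballP.
have [d d0 Hd] := cF e e0.
by exists d => // x /Hd; rewrite distrC.
Qed.

Lemma rV_norm_le (R : realType) (m : nat) (v : 'rV[R]_m) (B : R) :
  0 <= B -> (forall i, `|v 0 i| <= B) -> `|v| <= B.
Proof.
move=> B0 H; rewrite [`|v|]/Num.Def.normr/= mx_normrE.
by apply/bigmax_leP; split=> // -[i j] _ /=; rewrite ord1.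
Qed.

Lemma ler_coord (R : realType) (m : nat) (v : 'rV[R]_m) i : `|v 0 i| <= `|v|.
Proof.
rewrite [`|v|]/Num.Def.normr/= mx_normrE.
exact: (le_bigmax _ (fun ij : 'I_1 * 'I_m => `|v ij.1 ij.2|) (0, i)).
Qed.

Lemma mulmx_norm_le (R : realType) (m n : nat) (a : 'rV[R]_m) (B : 'M[R]_(m, n)) :
  `|a *m B| <= `|B| * m%:R * `|a|.
Proof.
apply: rV_norm_le; first by rewrite mulr_ge0 ?mulr_ge0 ?normr_ge0 ?ler0n.
move=> j; rewrite mxE (le_trans (ler_norm_sum _ _ _))//.
have -> : `|B| * m%:R * `|a| = \sum_(i < m) `|B| * `|a|.
  by rewrite sumr_const card_ord mulrAC mulr_natr.
apply: ler_sum => i _; rewrite normrM mulrC ler_pM ?ler_coord//.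
rewrite [leRHS]/Num.Def.normr/= mx_normrE.
exact: (le_bigmax _ (fun ij : 'I_m * 'I_n => `|B ij.1 ij.2|) (i, j)).
Qed.

Lemma is_derive_coordP (R : realType) (m : nat) (c : R -> 'rV[R]_m) (t : R) v :
  is_derive t 1 c v <-> forall i, is_derive t 1 (fun s => c s 0 i) (v 0 i).
Proof.
split=> [[dc <-] i|dc].
  have dci : derivable (fun s => c s 0 i) t 1 by move/derivable_mxP: dc.
  by apply: DeriveDef => //; rewrite derive_mx// mxE.
have dc' : derivable c t 1.
  by apply/derivable_mxP => i j; rewrite ord1; have [] := dc j.
apply: DeriveDef => //; rewrite derive_mx//; apply/rowP => i; rewrite mxE.
by have [_] := dc i.
Qed.

Lemma is_derive_cont (R : realType) (V : normedModType R) (c : R -> V) (t : R) v :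
  is_derive t 1 c v -> {for t, continuous c}.
Proof. by move=> [dc _]; apply/differentiable_continuous/derivable1_diffP. Qed.

Lemma mean_value_le (R : realType) (f df : R -> R) (a b B : R) : a <= b ->
  (forall t, a <= t <= b -> is_derive t 1 f (df t)) ->
  (forall t, a <= t <= b -> `|df t| <= B) -> `|f b - f a| <= B * (b - a).
Proof.
move=> ab df1 dfB; have [//|x xab|x|c cab ->] := @MVT_segment R f df a b.
- by apply: df1; move: xab; rewrite in_itv/= => /andP[/ltW -> /ltW ->].
- apply: continuous_in_subspaceT => {}x; rewrite inE/= in_itv/= => xab.
  exact: is_derive_cont (df1 x xab).
- rewrite normrM (ger0_norm (_ : 0 <= b - a)) ?subr_ge0// ler_wpM2r ?subr_ge0//.
  by apply: dfB; move: cab; rewrite in_itv.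
Qed.

(** The norm on rows is the maximum of the coordinates, so the scalar inequality in each coordinate
    loses no dimensional factor. *)
Lemma mean_value_le_rV (R : realType) (m : nat) (f df : R -> 'rV[R]_m) (a b B : R) :
  a <= b -> (forall t, a <= t <= b -> is_derive t 1 f (df t)) ->
  (forall t, a <= t <= b -> `|df t| <= B) -> `|f b - f a| <= B * (b - a).
Proof.
move=> ab df1 dfB.
have B0 : 0 <= B by apply: le_trans (dfB a _); rewrite ?lexx.
apply: rV_norm_le => [|i]; first by rewrite mulr_ge0 ?subr_ge0.
rewrite !mxE; apply: (@mean_value_le _ (fun t => f t 0 i) (fun t => df t 0 i)) => //.
  by move=> t /df1/is_derive_coordP.
by move=> t /dfB; apply: le_trans; exact: ler_coord.
Qed.

Lemma is_derive_comp_diff (R : realType) (V W : normedModType R) (F : V -> W)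
    (c : R -> V) (t : R) v :
  is_derive t 1 c v -> differentiable F (c t) ->
  is_derive t 1 (F \o c) ('d F (c t) v).
Proof.
move=> [dc <-] dF.
have dc' : differentiable c t by apply/derivable1_diffP.
have dFc : differentiable (F \o c) t by exact: differentiable_comp.
apply: DeriveDef; first exact/derivable1_diffP.
by rewrite deriveE// diff_comp//= deriveE.
Qed.

Lemma segment_ball (R : realType) (V : normedModType R) (p u v : V) (e t : R) :
  `|u - p| < e -> `|v - p| < e -> 0 <= t <= 1 -> `|v + t *: (u - v) - p| < e.
Proof.
move=> up vp /andP[t0 t1].
have -> : v + t *: (u - v) - p = (1 - t) *: (v - p) + t *: (u - p).
  rewrite scalerBl scale1r -[RHS]addrA [- _ + _]addrC -scalerBr.
  by rewrite [in RHS]opprB addrA subrK addrAC.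
have [->|t_neq0] := eqVneq t 0; first by rewrite subr0 scale1r scale0r addr0.
rewrite (le_lt_trans (ler_normD _ _))// !normrZ (ger0_norm t0) ger0_norm ?subr_ge0//.
have -> : e = (1 - t) * e + t * e by rewrite mulrBl mul1r subrK.
rewrite ler_ltD//; first by rewrite ler_wpM2l ?subr_ge0// ltW.
by rewrite ltr_pM2l// lt_neqAle eq_sym t_neq0.
Qed.

Lemma diff_sum_coord (R : realType) (m : nat) (W : normedModType R)
    (F : 'rV[R]_m -> W) (x w : 'rV[R]_m) : differentiable F x ->
  'd F x w = \sum_(i < m) w 0 i *: 'D_(delta_mx 0 i) F x.
Proof.
move=> dF; rewrite {1}(row_sum_delta w) linear_sum; apply: eq_bigr => i _.
by rewrite linearZ/= deriveE.
Qed.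

Lemma is_derive_line (R : realType) (V : normedModType R) (b v : V) (t : R) :
  is_derive t 1 (fun s : R => b + s *: v) v.
Proof.
have -> : (fun s : R => b + s *: v) = (cst b : R -> V) + (fun s => s *: v) by [].
have d2 : is_derive t 1 (fun s : R => s *: v) v.
  have h : differentiable (fun s : R => s *: v) t by [].
  apply: DeriveDef; first exact/derivable1_diffP.
  by rewrite deriveE// diff_val scale1r.
by rewrite -{2}(add0r v); exact: is_deriveD.
Qed.

(** The base point [b] is free while the derivatives are taken at the fixed [p]: this is stronger
    than differentiability at [p] and comes from the continuity of the derivatives there. Only the
    directions [e i] enter, so that for the retraction the fibre directions can be taken alone. *)
Lemma strict_diff (R : realType) (V : normedModType R) (m n : nat)
    (F : V -> 'rV[R]_n) (p : V) (e : 'I_m -> V) :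
  (\forall q \near p, differentiable F q) ->
  (forall i, {for p, continuous (fun q => 'D_(e i) F q)}) ->
  (forall a : 'rV[R]_m, `|\sum_i a 0 i *: e i| <= `|a|) ->
  forall eps : R, 0 < eps -> exists2 d, 0 < d &
    forall b (a : 'rV[R]_m), `|b - p| < d -> `|a| < d ->
      `|F (b + \sum_i a 0 i *: e i) - F b - \sum_i a 0 i *: 'D_(e i) F p|
        <= eps * `|a|.
Proof.
move=> dF cF he eps eps0.
have eps'0 : 0 < eps / m.+1%:R by rewrite divr_gt0.
have : \forall q \near p, differentiable F q /\
    forall i, `|'D_(e i) F q - 'D_(e i) F p| < eps / m.+1%:R.
  near=> q; split; first by near: q.
  near: q; apply: filter_forall => i.
  have [d d0 Hd] := (continuous_atP _ _).1 (cF i) _ eps'0.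
  by apply/near_ballP; exists d.
move=> /near_ballP[d d0 Hd].
exists (d / 2); first by rewrite divr_gt0.
move=> b a bp ad; set v := \sum_i _; set w := \sum_i _.
(* With the linear part subtracted, [c 1 - c 0] is the error to be bounded, and [c'] is a sum of [m]
   terms of size at most |a| eps / (m + 1). *)
pose c (t : R) := F (b + t *: v) - t *: w.
pose c' (t : R) := 'd F (b + t *: v) v - w.
have inball t : 0 <= t <= 1 -> `|b + t *: v - p| < d.
  move=> /andP[t0 t1]; rewrite addrAC (le_lt_trans (ler_normD _ _))//.
  rewrite (splitr d) ltr_leD// normrZ ger0_norm// -[leRHS]mul1r.
  by rewrite ler_pM// (le_trans (he a))// ltW.
have := @mean_value_le_rV R n c c' 0 1 (eps * `|a|) ler01.
rewrite subr0 mulr1 /c scale0r scale1r scale0r subr0 addr0 scale1r addrAC.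
apply=> t t01.
  apply: is_deriveB.
    apply: (@is_derive_comp_diff _ _ _ F (fun t => b + t *: v)).
      exact: is_derive_line.
    by have [] := Hd _ (inball _ t01).
  by have := @is_derive_line R _ 0 w t; under eq_fun do rewrite add0r.
have [dFt DFt] := Hd _ (inball _ t01).
have -> : c' t = \sum_i a 0 i *: ('D_(e i) F (b + t *: v) - 'D_(e i) F p).
  rewrite /c' /v linear_sum -/v /w -sumrB; apply: eq_bigr => i _.
  by rewrite linearZ/= scalerBr -deriveE//.
rewrite (le_trans (ler_norm_sum _ _ _))//.
apply: (@le_trans _ _ (\sum_(i < m) `|a| * (eps / m.+1%:R))).
  by apply: ler_sum => i _; rewrite normrZ ler_pM ?ler_coord// ltW.
rewrite sumr_const card_ord -[_ *+ m]mulr_natr -mulrA [leRHS]mulrC ler_wpM2l//.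
by rewrite -mulrA ler_piMr ?(ltW eps0)// mulrC ler_pdivrMr// mul1r ler_nat.
Unshelve. all: by end_near. Qed.

(** * Locally Lipschitz functions *)

Section LocallyLipschitz.
Context {R : realType} {V : normedModType R} (p : V).
Implicit Types F G : V -> R.

(** Lipschitz regularity is what the fixed point argument asks of the Christoffel symbols, and it
    passes through sums, products, inverses and determinants without computing any derivative. *)
Definition loc_lip F := exists e K : R, [/\ 0 < e, 0 <= K &
  forall u v, `|u - p| < e -> `|v - p| < e -> `|F u - F v| <= K * `|u - v|].

Lemma loc_lip_bounded F : loc_lip F -> exists e B : R, [/\ 0 < e, 0 <= B &
  forall u, `|u - p| < e -> `|F u| <= B].
Proof.
move=> [e [K [e0 K0 HF]]]; exists e, (`|F p| + K * e); split=> //.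
  by rewrite addr_ge0 ?mulr_ge0// ltW.
move=> u up; rewrite -(subrK (F p) (F u)) (le_trans (ler_normD _ _))// addrC lerD2l.
rewrite (le_trans (HF _ _ up _)) ?subrr ?normr0//.
by rewrite ler_wpM2l// ltW.
Qed.

Lemma eq_loc_lip F G : (\forall u \near p, F u = G u) -> loc_lip F -> loc_lip G.
Proof.
move=> /near_ballP[d d0 FG] [e [K [e0 K0 HF]]]; exists (Num.min d e), K.
by split; rewrite ?lt_min ?d0// => u v; rewrite !lt_min => /andP[? ?] /andP[? ?];
  rewrite -!FG//; exact: HF.
Qed.

Lemma loc_lip_cst (a : R) : loc_lip (cst a).
Proof. by exists 1, 0; split=> // u v _ _; rewrite subrr normr0 mul0r. Qed.

Lemma loc_lipD F G : loc_lip F -> loc_lip G -> loc_lip (fun u => F u + G u).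
Proof.
move=> [e [K [e0 K0 HF]]] [d [L [d0 L0 HG]]]; exists (Num.min d e), (K + L).
split; rewrite ?lt_min ?d0 ?addr_ge0// => u v; rewrite !lt_min => /andP[? ?] /andP[? ?].
by rewrite opprD addrACA (le_trans (ler_normD _ _))// mulrDl lerD ?HF ?HG.
Qed.

Lemma loc_lipM F G : loc_lip F -> loc_lip G -> loc_lip (fun u => F u * G u).
Proof.
move=> lF lG.
have [e' [B [e'0 B0 bF]]] := loc_lip_bounded lF.
have [d' [C [d'0 C0 bG]]] := loc_lip_bounded lG.
move: lF lG => [e [K [e0 K0 HF]]] [d [L [d0 L0 HG]]].
exists (Num.min (Num.min d e) (Num.min d' e')), (B * L + K * C).
split; rewrite ?lt_min ?d0 ?d'0 ?e0 ?addr_ge0 ?mulr_ge0// => u v.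
rewrite !lt_min => /andP[/andP[? ?] /andP[? ?]] /andP[/andP[? ?] /andP[? ?]].
have -> : F u * G u - F v * G v = F u * (G u - G v) + (F u - F v) * G v.
  by rewrite mulrBr mulrBl addrA subrK.
rewrite (le_trans (ler_normD _ _))// !normrM mulrDl -mulrA mulrAC lerD//.
  by rewrite ler_pM ?bF ?HG.
by rewrite ler_pM ?bG ?HF.
Qed.

Lemma loc_lipV F : F p != 0 -> loc_lip F -> loc_lip (fun u => (F u)^-1).
Proof.
move=> Fp [e [K [e0 K0 HF]]].
have Fp0 : 0 < `|F p| / 2 by rewrite divr_gt0// normr_gt0.
pose d := Num.min e (`|F p| / 2 / (K + 1)).
have K10 : 0 < K + 1 by rewrite ltr_wpDl.
have lowF u : `|u - p| < d -> `|F p| / 2 <= `|F u|.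
  rewrite lt_min => /andP[ue uF].
  have := HF _ _ ue (_ : `|p - p| < e); rewrite subrr normr0 => /(_ e0) h.
  have h2 : `|F u - F p| <= `|F p| / 2.
    rewrite (le_trans h)// (@le_trans _ _ ((K + 1) * `|u - p|))//.
      by rewrite ler_wpM2r// lerDl.
    by rewrite mulrC -ler_pdivlMr// ltW.
  by have := ler_normB (F u) (F u - F p); rewrite subKr; lra.
exists d, (K / (`|F p| / 2) ^+ 2); split.
- by rewrite lt_min e0 !divr_gt0// normr_gt0.
- by rewrite divr_ge0// exprn_ge0// ltW.
move=> u v ud vd.
have Fu := lowF _ ud; have Fv := lowF _ vd.
have Fu0 : F u != 0 by rewrite -normr_gt0 (lt_le_trans Fp0).
have Fv0 : F v != 0 by rewrite -normr_gt0 (lt_le_trans Fp0).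
have -> : (F u)^-1 - (F v)^-1 = (F v - F u) / (F u * F v).
  by field; rewrite Fu0 Fv0.
rewrite normrM normfV normrM mulrAC ler_pM ?invr_ge0 ?mulr_ge0//.
  move: ud vd; rewrite !lt_min => /andP[? _] /andP[? _].
  by rewrite distrC HF.
by rewrite lef_pV2 ?posrE ?exprn_gt0 ?mulr_gt0 ?normr_gt0// expr2 ler_pM ?(ltW Fp0).
Qed.

Lemma loc_lip_sum (I : Type) (s : seq I) (P : pred I) (F : I -> V -> R) :
  (forall i, loc_lip (F i)) -> loc_lip (fun u => \sum_(i <- s | P i) F i u).
Proof.
move=> lF; elim: s => [|i s IH].
  by under eq_fun do rewrite big_nil; exact: loc_lip_cst.
under eq_fun do rewrite big_cons.
by case: (P i) => //; apply: loc_lipD.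
Qed.

Lemma loc_lip_prod (I : Type) (s : seq I) (P : pred I) (F : I -> V -> R) :
  (forall i, loc_lip (F i)) -> loc_lip (fun u => \prod_(i <- s | P i) F i u).
Proof.
move=> lF; elim: s => [|i s IH].
  by under eq_fun do rewrite big_nil; exact: loc_lip_cst.
under eq_fun do rewrite big_cons.
by case: (P i) => //; apply: loc_lipM.
Qed.

Lemma loc_lip_det (k : nat) (A : V -> 'M[R]_k) :
  (forall i j, loc_lip (fun u => A u i j)) -> loc_lip (fun u => \det (A u)).
Proof.
move=> lA; apply: loc_lip_sum => s; apply: loc_lipM; first exact: loc_lip_cst.
exact: loc_lip_prod.
Qed.

(** By Cramer's rule the entries are cofactors divided by the determinant. [invmx] is given by this
    formula only where the matrix is invertible, hence the detour through a function equal to it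
    near [p]. *)
Lemma loc_lip_invmx (k : nat) (A : V -> 'M[R]_k) :
  (\forall u \near p, A u \in unitmx) ->
  (forall i j, loc_lip (fun u => A u i j)) ->
  forall i j, loc_lip (fun u => invmx (A u) i j).
Proof.
move=> uA lA i j.
apply: (@eq_loc_lip (fun u => (\det (A u))^-1 * ((-1) ^+ (j + i) *
    \det (row' j (col' i (A u)))))).
  by apply: filterS uA => u Au; rewrite /invmx Au !mxE.
apply: loc_lipM.
  apply: loc_lipV; last exact: loc_lip_det.
  by have := nbhs_singleton uA; rewrite unitmxE unitfE.
apply: loc_lipM; first exact: loc_lip_cst.
apply: loc_lip_det => a b.
by under eq_fun do rewrite !mxE; exact: lA.
Qed.

End LocallyLipschitz.

Lemma loc_lip_C1 (R : realType) (m : nat) (F : 'rV[R]_m -> R) (p : 'rV[R]_m) :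
  (\forall q \near p, differentiable F q) ->
  (forall i, {for p, continuous (fun q => 'D_(delta_mx 0 i) F q)}) ->
  loc_lip p F.
Proof.
move=> dF cF.
pose B := \sum_(i < m) (`|'D_(delta_mx 0 i) F p| + 1).
have : \forall q \near p, differentiable F q /\
    forall i, `|'D_(delta_mx 0 i) F q| <= `|'D_(delta_mx 0 i) F p| + 1.
  near=> q; split; first by near: q.
  near: q; apply: filter_forall => i.
  have [d d0 Hd] := (continuous_atP _ _).1 (cF i) _ ltr01.
  apply/(@near_ballP R 'rV[R]_m); exists d => // q /Hd qd.
  by rewrite -(subrK ('D_(delta_mx 0 i) F p) ('D_(delta_mx 0 i) F q))
    (le_trans (ler_normD _ _))// addrC lerD2l ltW.
move=> /(@near_ballP R 'rV[R]_m)[d d0 Hd]; exists d, B.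
split=> //; first by rewrite sumr_ge0.
move=> u v ud vd.
have := @mean_value_le R (fun t => F (v + t *: (u - v)))
  (fun t => 'd F (v + t *: (u - v)) (u - v)) 0 1 (B * `|u - v|) ler01.
rewrite subr0 mulr1 scale1r scale0r addr0 subrKC; apply=> t t01;
  have [dFt DFt] := Hd _ (segment_ball ud vd t01).
  by apply: (@is_derive_comp_diff _ _ _ F (fun t => v + t *: (u - v)));
    [exact: is_derive_line|].
rewrite diff_sum_coord// (le_trans (ler_norm_sum _ _ _))// /B mulr_suml.
by apply: ler_sum => i _; rewrite normrZ mulrC ler_pM ?ler_coord.
Unshelve. all: by end_near. Qed.

(** * Lifting curves through immersions *)

Lemma is_derive_epsP (R : realType) (V : normedModType R) (f : R -> V) (t : R) (a : V) :
  is_derive t 1 f a <->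
  forall e : R, 0 < e -> exists2 d : R, 0 < d &
    forall h, `|h| < d -> `|f (t + h) - f t - h *: a| <= e * `|h|.
Proof.
split=> [[df <-] e e0|H].
  have /(@derivableP _ _ _ f t 1) _ := df.
  move: df => /cvg_ex[/= l dl].
  have -> : 'D_1 f t = l by apply/cvg_lim.
  move/cvgrPdist_le : dl => /(_ e e0) [/= d d0 Hd].
  exists d => // h hd; have [->|h0] := eqVneq h 0.
    by rewrite addr0 subrr scale0r subr0 !normr0 mulr0.
  have := Hd h; rewrite /= sub0r normrN => /(_ hd h0).
  rewrite [h%:A]mulr1 distrC [t + h]addrC => {}Hd.
  have -> : f (h + t) - f t - h *: l = h *: (h^-1 *: (f (h + t) - f t) - l).
    by rewrite scalerBr scalerA mulfV// scale1r.
  by rewrite normrZ mulrC ler_wpM2r.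
have dl : h^-1 *: ((f \o shift t) (h *: 1) - f t) @[h --> 0^'] --> a.
  apply/cvgrPdist_le => e e0; have [d d0 Hd] := H e e0.
  near=> h.
  have h0 : h != 0 by near: h; exact: nbhs_dnbhs_neq.
  have hd : `|h| < d by near: h; exact: dnbhs0_lt.
  have := Hd _ hd; rewrite [t + h]addrC => {}Hd.
  rewrite [h%:A]mulr1 distrC -(ler_pM2r (_ : 0 < `|h|)) ?normr_gt0// mulrC -normrZ.
  by rewrite scalerBr scalerA mulfV// scale1r.
by apply: DeriveDef; [apply/cvg_ex; exists a|apply/cvg_lim].
Unshelve. all: by end_near. Qed.

Lemma differentiable_eps (R : realType) (V W : normedModType R) (F : V -> W) (p : V) :
  differentiable F p -> forall e : R, 0 < e -> exists2 d : R, 0 < d &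
    forall q, `|q - p| < d -> `|F q - F p - 'd F p (q - p)| <= e * `|q - p|.
Proof.
move=> dF e e0; have /eqaddoP/(_ e e0) := diff_locally dF.
move=> /(@near_ballP R V)[d d0 Hd]; exists d => // q qp.
have := Hd (q - p); rewrite subr0 => /(_ qp) /=.
rewrite !fctE /= subrK opprD addrA.
by [].
Qed.

Lemma linear_left_inverse (R : realType) (m n : nat)
    (l : {linear 'rV[R]_m -> 'rV[R]_n}) :
  injective l -> exists B : 'M[R]_(n, m), forall a, l a *m B = a.
Proof.
move=> linj; have /row_freeP[B lB] : row_free (lin1_mx l).
  apply: inj_row_free => v; rewrite mul_rV_lin1 => lv.
  by apply: linj; rewrite linear0.
by exists B => a; rewrite -mul_rV_lin1 -mulmxA lB mulmx1.
Qed.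

Lemma immersion_lower_bound (R : realType) (m n : nat)
    (l : {linear 'rV[R]_m -> 'rV[R]_n}) :
  injective l -> exists2 b : R, 0 < b & forall a, `|a| <= b * `|l a|.
Proof.
move=> /linear_left_inverse[B lB]; exists (`|B| * n%:R + 1).
  by rewrite ltr_wpDl ?mulr_ge0.
move=> a; rewrite -{1}(lB a) (le_trans (mulmx_norm_le _ _))//.
by rewrite ler_wpM2r// lerDl.
Qed.

(** A left inverse [B] of the differential turns the increment [dq] of [psi \o phi] into the
    increment [dp] of [phi], up to an error e2 |dp|; continuity of [phi] makes this available for
    small h. As e2 <= 1/2 the error can be absorbed, so |dp| = O(|h|), and then the error is small
    compared with h. *)
Lemma lift_derivable (R : realType) (m n : nat) (psi : 'rV[R]_m -> 'rV[R]_n)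
    (phi : R -> 'rV[R]_m) (t : R) (v : 'rV[R]_n) :
  differentiable psi (phi t) -> injective ('d psi (phi t)) ->
  {for t, continuous phi} -> is_derive t 1 (psi \o phi) v ->
  exists2 a, is_derive t 1 phi a & 'd psi (phi t) a = v.
Proof.
move=> dpsi ipsi cphi dcomp.
have [B lB] := linear_left_inverse ipsi.
suff dphi : is_derive t 1 phi (v *m B).
  exists (v *m B) => //; have [_ E1] := dcomp.
  by have [_ E2] := is_derive_comp_diff dphi dpsi; rewrite -E2 E1.
apply/is_derive_epsP => e e0.
pose b := `|B| * n%:R; have b0 : 0 <= b by rewrite mulr_ge0.
pose X := `|v *m B|; have X0 : 0 <= X by exact: normr_ge0.
pose e1 := e / (2 * (b + 1)).
have b10 : 0 < b + 1 by rewrite ltr_wpDl.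
have e10 : 0 < e1 by rewrite divr_gt0// mulr_gt0.
have e1b : e1 * b <= e / 2.
  have E1 : e1 * (2 * (b + 1)) = e by rewrite divfK// gt_eqF// mulr_gt0.
  by lra.
(* Absorption gives |dp| <= 2 |h| (X + e), so the second bound makes the error e2 |dp| at most (e /
   2) |h|. *)
pose e2 := Num.min (1 / 2) (e / (4 * (X + e))).
have Xe0 : 0 < X + e by rewrite ltr_wpDl.
have e20 : 0 < e2 by rewrite lt_min !divr_gt0// mulr_gt0.
have e2X : e2 * (4 * (X + e)) <= e.
  by rewrite -ler_pdivlMr ?mulr_gt0// ge_min lexx orbT.
have e22 : e2 <= 1 / 2 by rewrite ge_min lexx.
have [d1 d10 H1] := (is_derive_epsP _ _ _).1 dcomp e1 e10.
pose e3 := e2 / (b + 1); have e30 : 0 < e3 by rewrite divr_gt0.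
have [d2 d20 H2] := differentiable_eps dpsi e30.
have [d3 d30 H3] := (continuous_atP _ _).1 cphi d2 d20.
exists (Num.min d1 d3) => [|h]; rewrite lt_min ?d10// => /andP[h1 h3].
have := H1 _ h1; have := H2 _ (H3 (t + h) _); rewrite addrC addKr => /(_ h3).
rewrite /=; set dp := phi (t + h) - phi t.
set dq := psi (phi (t + h)) - psi (phi t) => E2 E1.
have F1 : `|dq *m B - h *: (v *m B)| <= e1 * b * `|h|.
  rewrite scalemxAl -mulmxBl (le_trans (mulmx_norm_le _ _))// -/b mulrC -mulrA.
  by rewrite [leRHS]mulrCA [leRHS]mulrC ler_wpM2r.
have F2 : `|dq *m B - dp| <= e2 * `|dp|.
  rewrite -{1}(lB dp) -mulmxBl (le_trans (mulmx_norm_le _ _))// -/b.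
  rewrite (@le_trans _ _ (b * (e3 * `|dp|)))// ?ler_wpM2l// mulrA ler_wpM2r//.
  by rewrite /e3 mulrCA ler_piMr ?(ltW e20)// ltW// ltr_pdivrMr// mul1r ltrDl.
have F3 : `|dp - h *: (v *m B)| <= e2 * `|dp| + e1 * b * `|h|.
  by rewrite (le_trans (ler_distD (dq *m B) _ _))// lerD// distrC.
have F4 : `|dp| <= `|h| * X + (e2 * `|dp| + e1 * b * `|h|).
  rewrite -(subrK (h *: (v *m B)) dp) (le_trans (ler_normD _ _))// addrC subrK.
  by rewrite lerD// normrZ.
have h0 : 0 <= `|h| := normr_ge0 h; have dp0 : 0 <= `|dp| := normr_ge0 dp.
have F5 : e2 * `|dp| <= 1 / 2 * `|dp| by rewrite ler_wpM2r.
have F6 : e1 * b * `|h| <= e / 2 * `|h| by rewrite ler_wpM2r.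
have eh0 : 0 <= e * `|h| by rewrite mulr_ge0// ltW.
have F7 : `|dp| <= 2 * (`|h| * (X + e)) by lra.
have F8 : e2 * `|dp| <= e2 * (2 * (`|h| * (X + e))) by rewrite ler_wpM2l// ltW.
have F9 : e2 * (4 * (X + e)) * `|h| <= e * `|h| by rewrite ler_wpM2r.
lra.
Qed.

(** The scalar [s] is there for the induction: the derivative of [G] in direction [v] is [v * s]
    times the derivative of [F] along [a], on the same line. *)
Lemma Ck_line (R : realType) (V W : normedModType R) (k : nat) (U : set V)
    (F : V -> W) (u a : V) (s : R) (J : set R) (G : R -> W) : open J ->
  (forall t, J t -> U (u + t *: a)) ->
  (forall t, J t -> G t = s *: F (u + t *: a)) -> Ck k U F -> Ck k J G.
Proof.
move=> oJ JU; elim: k s F G => [|k IH] s F G GF /=.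
  move=> cF t Jt; have nGF : \forall r \near t, s *: F (u + r *: a) = G r.
    by apply: filterS (open_nbhs_nbhs (conj oJ Jt)) => r /GF.
  rewrite /prop_for /continuous_at (GF _ Jt).
  apply: (cvg_trans (near_eq_cvg nGF)); apply: cvgZl_tmp.
  have cl : {for t, continuous (fun r : R => u + r *: a)}.
    exact: is_derive_cont (is_derive_line u a t).
  exact: continuous_comp cl (cF _ (JU _ Jt)).
move=> [dF CF].
have dG t : J t -> is_derive t 1 G (s *: 'D_a F (u + t *: a)).
  move=> Jt; have nGF : \forall r \near t, s *: F (u + r *: a) = G r.
    by apply: filterS (open_nbhs_nbhs (conj oJ Jt)) => r /GF.
  apply: near_eq_is_derive nGF _.
  apply: is_deriveZ; rewrite deriveE; last exact/dF/JU.
  apply: (is_derive_comp_diff (is_derive_line u a t)).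
  exact/dF/JU.
split=> [t Jt|v].
  by have [? _] := dG _ Jt; apply/derivable1_diffP.
apply: (IH (v * s) ('D_a F)) => // t Jt.
have [dGt DGt] := dG _ Jt; have dGt' : differentiable G t by apply/derivable1_diffP.
by rewrite deriveE// -[v in LHS]mulr1 linearZ/= -deriveE// DGt scalerA.
Qed.

(** * Charts and tangent spaces *)

Section ChartTheory.
Context {R : realType} {n m : nat} {M : set 'rV[R]_n} (C : chart m M).

Lemma crange_cmap x : M x -> cdom C x -> crange C (cmap C x).
Proof. by move=> Mx Cx; exists x. Qed.

Lemma cinvK u : crange C u -> cmap C (cinv C u) = u.
Proof. by move=> [x Cx <-]; rewrite cmapK. Qed.

Lemma crange_cinv u : crange C u -> M (cinv C u) /\ cdom C (cinv C u).
Proof. by move=> [x Cx <-]; rewrite cmapK. Qed.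

Lemma crange_near u : crange C u -> \forall v \near u, crange C v.
Proof. by move=> Cu; apply: open_nbhs_nbhs; split=> //; exact: crange_open. Qed.

Lemma cinv_diff u : crange C u -> differentiable (cinv C) u.
Proof. by move=> Cu; have [dC _] := @cinv_smooth _ _ _ _ C 1%N; exact: dC. Qed.

Lemma cinv_derive_cont u a : crange C u -> {for u, continuous ('D_a (cinv C))}.
Proof.
by move=> Cu; have [_ dC] := @cinv_smooth _ _ _ _ C 1%N; exact: dC.
Qed.

Lemma cinv_dinj u : crange C u -> injective ('d (cinv C) u : 'rV[R]_m -> 'rV[R]_n).
Proof. exact: cinv_immersion. Qed.

Lemma cmap_eps x : M x -> cdom C x -> forall e : R, 0 < e ->
  exists2 d : R, 0 < d & forall y, M y -> `|y - x| < d ->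
    cdom C y /\ `|cmap C y - cmap C x| < e.
Proof.
move=> Mx Cx e e0.
have /subspace_continuousP/(_ x (conj Mx Cx)) := @cmap_continuous _ _ _ _ C.
move=> /cvgrPdist_lt/(_ e e0); rewrite /within/= => H.
have H1 : \forall y \near x, (M `&` cdom C) y -> `|cmap C x - cmap C y| < e := H.
have H2 : \forall y \near x, cdom C y.
  by apply: open_nbhs_nbhs; split=> //; exact: cdom_open.
have [d d0 Hd] := (@near_ballP R 'rV[R]_n x _).1 (filterI H1 H2).
by exists d => // y My /Hd[/= h Cy]; split=> //; rewrite distrC; exact: h.
Qed.

Lemma curve_in_chart (c : R -> 'rV[R]_n) (t : R) : {for t, continuous c} ->
  (\forall s \near t, M (c s)) -> cdom C (c t) ->
  (\forall s \near t, M (c s) /\ cdom C (c s)) /\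
  {for t, continuous (cmap C \o c)}.
Proof.
move=> ct Mc Cct; have Mct := nbhs_singleton Mc.
have {}Mc : \forall s \near t, M (c s) /\ cdom C (c s).
  near=> s; split; first by near: s.
  near: s; have : \forall y \near c t, cdom C y.
    by apply: open_nbhs_nbhs; split=> //; exact: cdom_open.
  exact: ct.
split; [exact: Mc | apply/continuous_atP => e e0].
have [d d0 Hd] := cmap_eps Mct Cct e0.
have [d' d'0 Hd'] := (continuous_atP _ _).1 ct d d0.
have /(@near_ballP R R)[d2 d20 Hd2] := Mc.
exists (Num.min d' d2); first by rewrite lt_min d'0.
move=> s; rewrite lt_min => /andP[s1 s2] /=.
by have [] := Hd (c s) (Hd2 _ s2).1 (Hd' _ s1).
Unshelve. all: by end_near. Qed.

Lemma cmap_is_derive (c : R -> 'rV[R]_n) (t : R) v : is_derive t 1 c v ->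
  (\forall s \near t, M (c s)) -> cdom C (c t) ->
  exists2 a, is_derive t 1 (cmap C \o c) a & 'd (cinv C) (cmap C (c t)) a = v.
Proof.
move=> dc Mc Cct; have Mct := nbhs_singleton Mc.
have [Mc' cc] := curve_in_chart (is_derive_cont dc) Mc Cct.
have Ct := crange_cmap Mct Cct.
apply: lift_derivable => //; first exact: cinv_diff.
  exact: cinv_dinj.
apply: near_eq_is_derive dc; apply: filterS Mc' => s Cs /=.
by rewrite cmapK.
Qed.

(** A curve in [M] has derivable coordinates since [cinv] is an immersion; conversely, a straight
    line in the chart is mapped to a smooth curve. The set of velocities is thereby a linear
    space. *)
Lemma tangentP x v : M x -> cdom C x ->
  tangent M x v <-> exists a, 'd (cinv C) (cmap C x) a = v.
Proof.
move=> Mx Cx; split=> [[c [e [e0 Mc sc c0 c0v]]]|[a <-]].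
  have nc : \forall s \near (0 : R), M (c s).
    by apply/nbhs_ballP; exists e.
  have dc0 : is_derive (0 : R) (1 : R) c v.
    have [dc _] := sc 1%N; apply: DeriveDef; last by rewrite -derive1E.
    by apply/derivable1_diffP/dc/ballxx.
  have [|a _ <-] := cmap_is_derive dc0 nc; first by rewrite c0.
  by exists a; rewrite c0.
set u := cmap C x; have Cu : crange C u by exact: crange_cmap.
have /(@near_ballP R 'rV[R]_m)[e e0 He] := crange_near Cu.
have a0 : 0 < `|a| + 1 by rewrite ltr_wpDl.
have inr (t : R) : ball 0 (e / (`|a| + 1)) t -> crange C (u + t *: a).
  rewrite /ball/= sub0r normrN ltr_pdivlMr// => te; apply: He.
  rewrite addrC addKr normrZ (le_lt_trans _ te)// ler_wpM2l//.
  by rewrite lerDl.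
have dc (t : R) : ball 0 (e / (`|a| + 1)) t ->
    is_derive t 1 (fun t => cinv C (u + t *: a)) ('d (cinv C) (u + t *: a) a).
  move=> /inr Ct.
  apply: (is_derive_comp_diff (is_derive_line u a t)); exact: cinv_diff.
have e'0 : 0 < e / (`|a| + 1) by rewrite divr_gt0.
exists (fun t => cinv C (u + t *: a)), (e / (`|a| + 1)); split=> //.
- by move=> t /inr /crange_cinv[].
- move=> k; apply: (@Ck_line _ _ _ k (crange C) (cinv C) u a 1).
  + exact: ball_open.
  + exact: inr.
  + by move=> t _; rewrite scale1r.
  + exact: cinv_smooth.
- by rewrite scale0r addr0 cmapK.
- by have [_] := dc _ (ballxx _ e'0); rewrite derive1E scale0r addr0.
Qed.

Lemma dchartK x v : M x -> cdom C x -> tangent M x v ->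
  'd (cinv C) (cmap C x) (dchart C x v) = v.
Proof.
move=> Mx Cx /(tangentP _ Mx Cx)[a av].
by apply: (@xgetPex _ 0 [set a | 'd (cinv C) (cmap C x) a = v]); exists a.
Qed.

Lemma dchart_d x a : M x -> cdom C x ->
  dchart C x ('d (cinv C) (cmap C x) a) = a.
Proof.
move=> Mx Cx; apply: (cinv_dinj (crange_cmap Mx Cx)).
by rewrite dchartK//; apply/tangentP => //; exists a.
Qed.

Lemma tangent_d u a : crange C u -> tangent M (cinv C u) ('d (cinv C) u a).
Proof.
move=> Cu; have [Mu Du] := crange_cinv Cu.
by apply/tangentP => //; exists a; rewrite cinvK.
Qed.

Lemma tangent0 x : M x -> cdom C x -> tangent M x 0.
Proof. by move=> Mx Cx; apply/tangentP => //; exists 0; rewrite linear0. Qed.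

Lemma tangentZ x (s : R) v : M x -> cdom C x -> tangent M x v ->
  tangent M x (s *: v).
Proof.
move=> Mx Cx /(tangentP _ Mx Cx)[a <-].
by apply/tangentP => //; exists (s *: a); rewrite linearZ.
Qed.

Lemma dchartB x v w : M x -> cdom C x -> tangent M x v -> tangent M x w ->
  dchart C x (v - w) = dchart C x v - dchart C x w.
Proof.
move=> Mx Cx /(tangentP _ Mx Cx)[a <-] /(tangentP _ Mx Cx)[b <-].
by rewrite -linearB !dchart_d.
Qed.

Lemma dchartZ x (s : R) v : M x -> cdom C x -> tangent M x v ->
  dchart C x (s *: v) = s *: dchart C x v.
Proof. by move=> Mx Cx /(tangentP _ Mx Cx)[a <-]; rewrite -linearZ !dchart_d. Qed.

End ChartTheory.

(** * The metric in a chart and the speed of geodesics *)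

Lemma linear_form_sum (R : realType) (m : nat) (phi : 'rV[R]_m -> R) (Y : 'rV[R]_m) :
  (forall a u v, phi (a *: u + v) = a * phi u + phi v) ->
  phi Y = \sum_(i < m) Y 0 i * phi (delta_mx 0 i).
Proof.
move=> lin; have lin' : linear (phi : 'rV[R]_m -> R^o) by [].
pose lM := GRing.isLinear.Build _ _ _ _ _ lin'.
pose L : {linear 'rV[R]_m -> R^o} := HB.pack (phi : _ -> R^o) lM.
have -> : phi Y = L Y by [].
rewrite {1}(row_sum_delta Y) linear_sum; apply: eq_bigr => i _.
by rewrite linearZ.
Qed.

Lemma is_derive_bigsum (R : realType) (I : finType) (V : normedModType R)
    (f : I -> R -> V) (t : R) (df : I -> V) :
  (forall i, is_derive t 1 (f i) (df i)) ->
  is_derive t 1 (fun s => \sum_i f i s) (\sum_i df i).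
Proof.
move=> dfi; elim: (index_enum I) => [|i s IH].
  rewrite big_nil; under eq_fun do rewrite big_nil.
  exact: is_derive_cst.
by rewrite big_cons; under eq_fun do rewrite big_cons; exact: is_deriveD.
Qed.

(** Here [D k i j] stands for the k-th partial derivative of the metric coefficient [G i j], [W] for
    the derivative of the velocity [V], and the second hypothesis is the geodesic equation with
    lowered index. Contracted three times with [V], the three terms of the Christoffel symbol all
    become the same cubic sum [T] by renaming indices; the derivative of the squared speed is then 2
    (- T / 2) + T. *)
Lemma metric_compat_algebra (R : realType) (m : nat) (V W : 'I_m -> R)
    (G : 'I_m -> 'I_m -> R) (D : 'I_m -> 'I_m -> 'I_m -> R) :
  (forall i j, G i j = G j i) ->
  (forall i, \sum_j G i j * W j =
     - \sum_a \sum_b V a * V b * (2^-1 * (D a b i + D b a i - D i a b))) ->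
  \sum_i \sum_j ((V i * W j + V j * W i) * G i j
                 + V i * V j * \sum_k V k * D k i j) = 0.
Proof.
move=> Gs HW.
pose T := \sum_i \sum_j \sum_k V i * V j * V k * D k i j.
have T3 : \sum_i \sum_j V i * V j * (\sum_k V k * D k i j) = T.
  apply: eq_bigr => i _; apply: eq_bigr => j _; rewrite mulr_sumr.
  by apply: eq_bigr => k _; rewrite mulrA.
have S : \sum_i V i * (\sum_j G i j * W j) = - (2^-1 * T).
  under eq_bigr => i _ do rewrite HW mulrN mulr_sumr.
  rewrite sumrN; congr (- _).
  have E1 : \sum_i \sum_a V i * (\sum_b V a * V b * (2^-1 * (D a b i + D b a i - D i a b)))
    = 2^-1 * (\sum_i \sum_a \sum_b V i * V a * V b * D a b i
             + \sum_i \sum_a \sum_b V i * V a * V b * D b a i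
             - \sum_i \sum_a \sum_b V i * V a * V b * D i a b).
    rewrite -big_split -sumrB mulr_sumr; apply: eq_bigr => i _.
    rewrite -big_split -sumrB mulr_sumr; apply: eq_bigr => a _.
    rewrite -big_split -sumrB !mulr_sumr; apply: eq_bigr => b _ /=.
    by ring.
  rewrite E1.
  have -> : \sum_i \sum_a \sum_b V i * V a * V b * D a b i = T.
    rewrite /T exchange_big/=.
    rewrite [RHS](eq_bigr _ (fun i _ => exchange_big _ _ _ _ _ _))/=.
    rewrite [RHS]exchange_big/=; apply: eq_bigr => a _.
    rewrite exchange_big/=; apply: eq_bigr => b _; apply: eq_bigr => i _.
    by ring.
  have -> : \sum_i \sum_a \sum_b V i * V a * V b * D b a i = T.
    rewrite /T exchange_big/=; apply: eq_bigr => a _; apply: eq_bigr => i _.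
    by apply: eq_bigr => b _; ring.
  have -> : \sum_i \sum_a \sum_b V i * V a * V b * D i a b = T.
    rewrite /T exchange_big/=; apply: eq_bigr => a _.
    rewrite exchange_big/=; apply: eq_bigr => b _; apply: eq_bigr => i _.
    by ring.
  by rewrite addrK.
under eq_bigr => i _ do rewrite big_split/=.
rewrite big_split/= T3.
have -> : \sum_i \sum_j (V i * W j + V j * W i) * G i j =
    2 * \sum_i V i * (\sum_j G i j * W j).
  have -> : \sum_i \sum_j (V i * W j + V j * W i) * G i j =
    \sum_i \sum_j V i * (G i j * W j) + \sum_i \sum_j V j * (G i j * W i).
    rewrite -big_split; apply: eq_bigr => i _; rewrite -big_split.
    by apply: eq_bigr => j _ /=; ring.
  rewrite [X in _ + X]exchange_big/= mulrDl mul1r; congr (_ + _).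
    by apply: eq_bigr => i _; rewrite mulr_sumr.
  by apply: eq_bigr => i _; rewrite mulr_sumr; apply: eq_bigr => j _; rewrite Gs.
rewrite S; lra.
Qed.

Section MetricTheory.
Context {R : realType} {n m : nat} {M : set 'rV[R]_n}.
Context (g : 'rV[R]_n -> 'rV[R]_n -> 'rV[R]_n -> R).
Hypothesis hg : riemannian_metric m M g.
Implicit Types (C : chart m M) (u X Y Z : 'rV[R]_m).

Definition gform C u Y Z := \sum_i \sum_j Y 0 i * Z 0 j * gram g C u i j.

Definition chris C u X Y : 'rV[R]_m :=
  \row_k \sum_i \sum_j christoffel g C u k i j * X 0 i * Y 0 j.

Lemma gram_sym C u i j : crange C u -> gram g C u i j = gram g C u j i.
Proof.
move=> Cu; have [Mu Du] := crange_cinv Cu; have [gs _ _ _] := hg.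
by rewrite !mxE gs//; exact: tangent_d.
Qed.

Lemma metric_formE C u Y Z : crange C u ->
  g (cinv C u) ('d (cinv C) u Y) ('d (cinv C) u Z) = gform C u Y Z.
Proof.
move=> Cu; have [Mu Du] := crange_cinv Cu; have [gs gl _ _] := hg.
pose phi Y := g (cinv C u) ('d (cinv C) u Y) ('d (cinv C) u Z).
have -> : g (cinv C u) ('d (cinv C) u Y) ('d (cinv C) u Z) = phi Y by [].
rewrite (linear_form_sum (phi := phi)); last first.
  by move=> a v w; rewrite /phi linearP gl//; exact: tangent_d.
apply: eq_bigr => i _; rewrite /phi gs//; try exact: tangent_d.
pose psi Z := g (cinv C u) ('d (cinv C) u Z) ('d (cinv C) u (delta_mx 0 i)).
rewrite -[g _ _ _]/(psi Z) (linear_form_sum (phi := psi)); last first.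
  by move=> a v w; rewrite /psi linearP gl//; exact: tangent_d.
rewrite mulr_sumr; apply: eq_bigr => j _.
by rewrite [gram _ _ _ i j]gram_sym// mxE mulrA.
Qed.

Lemma metric_chartE C x v w : M x -> cdom C x -> tangent M x v ->
  tangent M x w -> g x v w = gform C (cmap C x) (dchart C x v) (dchart C x w).
Proof.
move=> Mx Cx tv tw; rewrite -metric_formE; last exact: crange_cmap.
by rewrite cmapK// !dchartK.
Qed.

Lemma gform_gt0 C u Y : crange C u -> Y != 0 -> 0 < gform C u Y Y.
Proof.
move=> Cu Y0; have [Mu Du] := crange_cinv Cu; have [_ _ gp _] := hg.
rewrite -metric_formE//; apply: gp => //; first exact: tangent_d.
by apply: contra_neq Y0 => Y0; apply: (cinv_dinj Cu); rewrite Y0 linear0.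
Qed.

(** A nonzero vector in the kernel would have length zero, against positivity. *)
Lemma gram_unit C u : crange C u -> gram g C u \in unitmx.
Proof.
move=> Cu; rewrite -row_free_unit; apply: inj_row_free => a aG.
apply/eqP; apply: contraT => /(gform_gt0 Cu).
rewrite /gform exchange_big/= big1 ?ltxx// => j _.
under eq_bigr => i _ do rewrite [a 0 i * _]mulrC -mulrA.
rewrite -mulr_sumr; have := congr1 (fun w : 'rV[R]_m => w 0 j) aG.
by rewrite !mxE => ->; rewrite mulr0.
Qed.

Lemma gram_diff C u i j : crange C u -> differentiable (fun v => gram g C v i j) u.
Proof. by move=> Cu; have [_ _ _ /(_ C i j 1%N)[+ _]] := hg; apply. Qed.

Lemma loc_lip_gram C u i j : crange C u -> loc_lip u (fun v => gram g C v i j).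
Proof.
move=> Cu; apply: loc_lip_C1.
  by apply: filterS (crange_near Cu) => v; exact: gram_diff.
by move=> k; have [_ _ _ /(_ C i j 1%N)[_]] := hg; apply.
Qed.

Lemma loc_lip_gram_derive C u i j k : crange C u ->
  loc_lip u ('D_(delta_mx 0 k) (fun v => gram g C v i j)).
Proof.
move=> Cu; have [_ _ _ /(_ C i j 2%N)[_ /(_ (delta_mx 0 k))[dD cD]]] := hg.
apply: loc_lip_C1.
  by apply: filterS (crange_near Cu) => v; exact: dD.
by move=> l; exact: cD.
Qed.

Lemma loc_lip_christoffel C u k i j : crange C u ->
  loc_lip u (fun v => christoffel g C v k i j).
Proof.
move=> Cu; apply: loc_lipM; first exact: loc_lip_cst.
apply: loc_lip_sum => l; apply: loc_lipM.
  apply: loc_lip_invmx; last by move=> a b; exact: loc_lip_gram.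
  by apply: filterS (crange_near Cu) => v; exact: gram_unit.
have lN (F : 'rV[R]_m -> R) : loc_lip u F -> loc_lip u (fun v => - F v).
  move=> lF; under eq_fun do rewrite -mulN1r.
  by apply: loc_lipM => //; exact: loc_lip_cst.
by apply: loc_lipD; [apply: loc_lipD|apply: lN]; exact: loc_lip_gram_derive.
Qed.

Lemma christoffel_lower C u i j l : crange C u ->
  \sum_k gram g C u l k * christoffel g C u k i j =
  2^-1 * ('D_(delta_mx 0 i) (fun v => gram g C v j l) u
        + 'D_(delta_mx 0 j) (fun v => gram g C v i l) u
        - 'D_(delta_mx 0 l) (fun v => gram g C v i j) u).
Proof.
move=> Cu; rewrite /christoffel.
pose T l' := 'D_(delta_mx 0 i) (fun v => gram g C v j l') u
  + 'D_(delta_mx 0 j) (fun v => gram g C v i l') u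
  - 'D_(delta_mx 0 l') (fun v => gram g C v i j) u.
transitivity (\sum_k gram g C u l k *
    (2^-1 * \sum_l' invmx (gram g C u) k l' * T l')); first by [].
rewrite -[RHS]/(2^-1 * T l).
under eq_bigr => k _ do rewrite mulrCA mulr_sumr.
rewrite -mulr_sumr exchange_big/=; congr (_ * _).
rewrite (bigD1 l)//= [X in _ + X]big1 ?addr0 => [|l' l'l];
  under eq_bigr => k _ do rewrite mulrA; rewrite -mulr_suml;
  have := mulmxV (gram_unit Cu).
  by move=> /matrixP/(_ l l); rewrite mxE [RHS]mxE eqxx => ->; rewrite mul1r.
move=> /matrixP/(_ l l'); rewrite mxE [RHS]mxE eq_sym (negbTE l'l) => ->.
by rewrite mul0r.
Qed.

Lemma chris_lower C u V l : crange C u ->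
  \sum_k gram g C u l k * chris C u V V 0 k =
  \sum_a \sum_b V 0 a * V 0 b * (2^-1 *
    ('D_(delta_mx 0 a) (fun v => gram g C v b l) u
        + 'D_(delta_mx 0 b) (fun v => gram g C v a l) u
        - 'D_(delta_mx 0 l) (fun v => gram g C v a b) u)).
Proof.
move=> Cu; under eq_bigr => k _ do rewrite [chris _ _ _ _ 0 k]mxE mulr_sumr.
rewrite exchange_big/=; apply: eq_bigr => a _.
under eq_bigr => k _ do rewrite mulr_sumr.
rewrite exchange_big/=; apply: eq_bigr => b _.
rewrite -christoffel_lower// mulr_sumr; apply: eq_bigr => k _; ring.
Qed.

Lemma gform_geodesic_derive C (c V : R -> 'rV[R]_m) (t : R) :
  crange C (c t) -> is_derive t 1 c (V t) ->
  is_derive t 1 V (- chris C (c t) (V t) (V t)) ->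
  is_derive t 1 (fun s => gform C (c s) (V s) (V s)) 0.
Proof.
move=> Cu dc /is_derive_coordP dV.
set u := c t in Cu *.
have dG i j : is_derive t 1 (fun s => gram g C (c s) i j)
    (\sum_k V t 0 k * 'D_(delta_mx 0 k) (fun v => gram g C v i j) u).
  have := is_derive_comp_diff dc (gram_diff i j Cu).
  by rewrite diff_sum_coord//; exact: gram_diff.
pose W j := - chris C u (V t) (V t) 0 j.
have dsum : is_derive t 1 (fun s => gform C (c s) (V s) (V s))
    (\sum_i \sum_j ((V t 0 i * W j + V t 0 j * W i) * gram g C u i j
      + V t 0 i * V t 0 j *
        \sum_k V t 0 k * 'D_(delta_mx 0 k) (fun v => gram g C v i j) u)).
  apply: is_derive_bigsum => i; apply: is_derive_bigsum => j.
  have h := is_deriveM (is_deriveM (dV i) (dV j)) (dG i j).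
  apply: is_derive_eq h _; rewrite /W ![(- chris _ _ _ _) 0 _]mxE.
  rewrite /= !fctE -/u -![_ *: _]/(_ * _); ring.
apply: is_derive_eq dsum _; apply: metric_compat_algebra.
  by move=> i j; exact: gram_sym.
move=> l; under eq_bigr => k _ do rewrite mulrN.
by rewrite sumrN chris_lower.
Qed.

End MetricTheory.

Lemma loc_lip_unif (R : realType) (V : normedModType R) (p : V) (I : finType)
    (F : I -> V -> R) : (forall i, loc_lip p (F i)) ->
  exists e K : R, [/\ 0 < e, 0 <= K &
    forall u v, `|u - p| < e -> `|v - p| < e -> forall i,
      `|F i u| <= K /\ `|F i u - F i v| <= K * `|u - v|].
Proof.
move=> lF.
suff [e [K [e0 K0 H]]] : exists e K : R, [/\ 0 < e, 0 <= K &
    forall u v, `|u - p| < e -> `|v - p| < e -> forall i, i \in enum I ->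
      `|F i u| <= K /\ `|F i u - F i v| <= K * `|u - v|].
  by exists e, K; split=> // u v ue ve i; apply: H => //; rewrite mem_enum.
elim: (enum I) => [|i s [e [K [e0 K0 H]]]]; first by exists 1, 0; split.
have [e' [B [e'0 B0 HB]]] := loc_lip_bounded (lF i).
have [d [L [d0 L0 HL]]] := lF i.
exists (Num.min e (Num.min e' d)), (K + (B + L)).
split; rewrite ?lt_min ?e0 ?e'0 ?addr_ge0// => u v.
rewrite !lt_min => /and3P[ue ue' ud] /and3P[ve ve' vd] k.
have KB : K <= K + (B + L) by rewrite lerDl addr_ge0.
have BK : B <= K + (B + L) by rewrite addrCA lerDl addr_ge0.
have LK : L <= K + (B + L) by rewrite addrA lerDr addr_ge0.
rewrite inE => /orP[/eqP -> |ks].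
  split; first exact: le_trans (HB _ ue') BK.
  by rewrite (le_trans (HL _ _ ud vd))// ler_wpM2r.
have [h1 h2] := H _ _ ue ve _ ks.
by split; [exact: le_trans KB|rewrite (le_trans h2)// ler_wpM2r].
Qed.

(** * Local bounds for the metric and the Christoffel symbols *)

Section MetricBounds.
Context {R : realType} {n m : nat} {M : set 'rV[R]_n}.
Context (g : 'rV[R]_n -> 'rV[R]_n -> 'rV[R]_n -> R).
Hypothesis hg : riemannian_metric m M g.
Implicit Types (C : chart m M) (u v X Y Z : 'rV[R]_m).

Lemma double_sum_le (A : 'I_m -> 'I_m -> R) X Y (B : R) :
  (forall i j, `|A i j| <= B) ->
  `|\sum_i \sum_j A i j * X 0 i * Y 0 j| <= m%:R * m%:R * B * `|X| * `|Y|.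
Proof.
move=> AB; rewrite (le_trans (ler_norm_sum _ _ _))//.
rewrite (@le_trans _ _ (\sum_(i < m) \sum_(j < m) B * `|X| * `|Y|))//.
  apply: ler_sum => i _; rewrite (le_trans (ler_norm_sum _ _ _))//.
  by apply: ler_sum => j _; rewrite !normrM !ler_pM ?mulr_ge0 ?ler_coord.
by rewrite !sumr_const !card_ord -mulrnA -[leLHS]mulr_natl natrM !mulrA.
Qed.

Lemma chris_bounds C u0 : crange C u0 -> exists r K : R, [/\ 0 < r, 0 <= K &
  forall u v X Y, `|u - u0| < r -> `|v - u0| < r ->
    `|chris g C u X Y| <= K * `|X| * `|Y| /\
    `|chris g C u X Y - chris g C v X Y| <= K * `|u - v| * `|X| * `|Y|].
Proof.
move=> Cu0; have [r [K [r0 K0 H]]] := @loc_lip_unif R 'rV[R]_m u0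
  ('I_m * 'I_m * 'I_m)%type (fun k v => christoffel g C v k.1.1 k.1.2 k.2)
  (fun k => loc_lip_christoffel hg k.1.1 k.1.2 k.2 Cu0).
exists r, (m%:R * m%:R * K); split=> //; first by rewrite !mulr_ge0.
move=> u v X Y ur vr; split.
  apply: rV_norm_le => [|k]; first by rewrite !mulr_ge0.
  rewrite mxE; apply: double_sum_le => i j.
  by have [] := H _ _ ur vr (k, i, j).
apply: rV_norm_le => [|k]; first by rewrite !mulr_ge0.
rewrite -[_ * K * _]mulrA !mxE -sumrB.
rewrite (eq_bigr (fun i => \sum_j (christoffel g C u k i j - christoffel g C v k i j)
    * X 0 i * Y 0 j)) => [|i _]; last first.
  by rewrite -sumrB; apply: eq_bigr => j _; rewrite !mulrBl.
apply: double_sum_le => i j.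
by have [_] := H _ _ ur vr (k, i, j).
Qed.

Lemma gform_continuous C u : continuous (fun a => gform g C u a a).
Proof.
move=> a; rewrite /gform.
apply: (@differentiable_continuous _ 'rV[R]_m R).
have -> : (fun b : 'rV[R]_m => \sum_i \sum_j b 0 i * b 0 j * gram g C u i j)
  = \sum_i \sum_j (fun b : 'rV[R]_m => b 0 i * b 0 j * gram g C u i j).
  by apply/funext => b; rewrite fct_sumE; apply: eq_bigr => i _; rewrite fct_sumE.
apply: differentiable_sum => i; apply: differentiable_sum => j.
apply: differentiableM; last exact: differentiable_cst.
by apply: differentiableM; exact: differentiable_coord.
Qed.

Lemma gformZ C u (s : R) a : gform g C u (s *: a) (s *: a) = s ^+ 2 * gform g C u a a.
Proof.
rewrite /gform mulr_sumr; apply: eq_bigr => i _; rewrite mulr_sumr.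
by apply: eq_bigr => j _; rewrite !mxE; ring.
Qed.

(** The constant is the minimum of the form on the compact unit sphere of the sup norm; homogeneity
    of degree 2 does the rest. *)
Lemma gform_lower C u : crange C u ->
  exists2 c : R, 0 < c & forall a, c * `|a| ^+ 2 <= gform g C u a a.
Proof.
move=> Cu; pose S := [set a : 'rV[R]_m | `|a| = 1].
have cS : compact S.
  apply: bounded_closed_compact.
    exists 1; split; first exact: num_real.
    by move=> y y1 a /= ->; exact: ltW.
  apply: (@closed_comp _ _ (fun a : 'rV[R]_m => `|a|) [set 1]) => //.
  by move=> a _; exact: norm_continuous.
(* For [m = 0] the sphere is empty, and the only vector is 0. *)
have [[a0 Sa0]|S0] := pselect (S !=set0); last first.
  exists 1 => // a; have [->|a0] := eqVneq a 0.
    rewrite normr0 expr0n mulr0 /gform big1// => i _.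
    by rewrite big1// => j _; rewrite mxE !mul0r.
  exfalso; apply: S0; exists (`|a|^-1 *: a); rewrite /S/= normrZ normfV normr_id.
  by rewrite mulVf// normr_eq0.
have [a1 Sa1 mina1] := EVT_min_rV (ex_intro _ a0 Sa0) cS
  (continuous_subspaceT (@gform_continuous C u)).
rewrite inE in Sa1.
exists (gform g C u a1 a1).
  by apply: gform_gt0 => //; rewrite -normr_eq0 Sa1 oner_eq0.
move=> a; have [->|a_neq0] := eqVneq a 0.
  rewrite normr0 expr0n mulr0 /gform big1// => i _.
  by rewrite big1// => j _; rewrite mxE !mul0r.
have na0 : `|a| != 0 by rewrite normr_eq0.
have aE : a = `|a| *: (`|a|^-1 *: a) by rewrite scalerA mulfV// scale1r.
rewrite [in leRHS]aE gformZ mulrC ler_wpM2l ?exprn_ge0//.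
by apply: mina1; rewrite inE /S/= normrZ normfV normr_id mulVf.
Qed.

Lemma metric_bounds C u0 : crange C u0 -> exists r c1 c2 : R,
  [/\ 0 < r, 0 < c1, 0 < c2 & forall u, `|u - u0| < r -> crange C u /\
    forall a, c1 * `|a| <= rnorm g (cinv C u) ('d (cinv C) u a) <= c2 * `|a| ].
Proof.
move=> Cu0; have [c c0 Hc] := gform_lower Cu0.
have [r1 [K [r10 K0 H]]] := @loc_lip_unif R 'rV[R]_m u0
  ('I_m * 'I_m)%type (fun k v => gram g C v k.1 k.2)
  (fun k => loc_lip_gram hg k.1 k.2 Cu0).
have /(@near_ballP R 'rV[R]_m)[r2 r20 H2] := crange_near Cu0.
pose L := m%:R * m%:R * K + 1.
have mK0 : 0 <= m%:R * m%:R * K by rewrite !mulr_ge0.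
have L0 : 0 < L by rewrite ltr_wpDl.
(* [K] bounds both the Gram coefficients and their Lipschitz constants. On this ball the form
   differs from the one at [u0] by at most (c / 2) |a|^2, half of the lower bound there. *)
pose r := Num.min (Num.min r1 r2) (c / 2 / L).
have r0 : 0 < r by rewrite !lt_min r10 r20 !divr_gt0.
exists r, (Num.sqrt (c / 2)), (Num.sqrt L); split=> //; rewrite ?sqrtr_gt0 ?divr_gt0//.
move=> u; rewrite !lt_min => /andP[/andP[ur1 ur2] ur3].
have u0r1 : `|u0 - u0| < r1 by rewrite subrr normr0.
split=> [|a]; first exact: H2.
rewrite /rnorm metric_formE; [|by []|exact: H2].
have gup : `|gform g C u a a| <= m%:R * m%:R * K * `|a| * `|a|.
  rewrite /gform (eq_bigr (fun i => \sum_j gram g C u i j * a 0 i * a 0 j)); last first.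
    by move=> i _; apply: eq_bigr => j _; ring.
  by apply: double_sum_le => i j; have [] := H _ _ ur1 u0r1 (i, j).
have gdiff : `|gform g C u a a - gform g C u0 a a| <=
    m%:R * m%:R * (K * `|u - u0|) * `|a| * `|a|.
  rewrite /gform -sumrB (eq_bigr (fun i => \sum_j (gram g C u i j - gram g C u0 i j)
     * a 0 i * a 0 j)); last first.
    by move=> i _; rewrite -sumrB; apply: eq_bigr => j _; rewrite -mulrBr mulrC mulrA.
  by apply: double_sum_le => i j; have [_] := H _ _ ur1 u0r1 (i, j).
have aa0 : 0 <= `|a| ^+ 2 by rewrite exprn_ge0.
have small : m%:R * m%:R * (K * `|u - u0|) <= c / 2.
  rewrite mulrA (@le_trans _ _ (L * `|u - u0|))//; first by rewrite ler_wpM2r// lerDl.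
  by rewrite mulrC -ler_pdivlMr// ltW.
have na : `|a| = Num.sqrt (`|a| ^+ 2) by rewrite sqrtr_sqr normr_id.
rewrite na -!sqrtrM ?(ltW L0) ?divr_ge0 ?(ltW c0)//.
have h1 : m%:R * m%:R * (K * `|u - u0|) * `|a| ^+ 2 <= c / 2 * `|a| ^+ 2.
  by rewrite ler_wpM2r.
have {}Hc := Hc a.
move: gdiff gup => /ler_normlP[g1 g2] /ler_normlP[g3 g4].
move: g1 g2 g3 g4 h1 Hc; rewrite /L -![_ * `|a| * `|a|]mulrA -[`|a| * `|a|]expr2.
move: (gform g C u a a) (gform g C u0 a a) (`|a| ^+ 2) aa0 => q q0 w w0.
move: (m%:R * m%:R * (K * _)) (m%:R * m%:R * K) => A B g1 g2 g3 g4 h1 {}Hc.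
by apply/andP; split; apply: ler_wsqrtr; lra.
Qed.

End MetricBounds.

Section GeodesicSpeed.
Context {R : realType} {n m : nat} {M : set 'rV[R]_n}.
Context (g : 'rV[R]_n -> 'rV[R]_n -> 'rV[R]_n -> R).
Hypothesis hg : riemannian_metric m M g.
Implicit Types (C : chart m M) (c V : R -> 'rV[R]_n).

Lemma parallel_at_curve C c V t : parallel_at g C c V t ->
  [/\ (\forall s \near t, M (c s) /\ cdom C (c s)), {for t, continuous c},
      is_derive t 1 (cmap C \o c) (coordV C c (derive1 c) t),
      tangent M (c t) (derive1 c t)
    & 'd (cinv C) (cmap C (c t)) (coordV C c (derive1 c) t) = derive1 c t].
Proof.
move=> [H _ _]; have [Mct Cct dc _] := nbhs_singleton H.
have nM : \forall s \near t, M (c s) by apply: filterS H => s [].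
have nMC : \forall s \near t, M (c s) /\ cdom C (c s).
  by apply: filterS H => s [].
have dc1 : is_derive t 1 c (derive1 c t) by apply: DeriveDef; rewrite ?derive1E.
have [a da aE] := cmap_is_derive dc1 nM Cct.
have tc : tangent M (c t) (derive1 c t) by apply/(tangentP _ Mct Cct); exists a.
have Ea : coordV C c (derive1 c) t = a by rewrite /coordV -aE dchart_d.
split; [exact: nMC | exact: is_derive_cont dc1 | by rewrite Ea | exact: tc | by rewrite Ea].
Qed.

Lemma parallel_at_derive C c V t : parallel_at g C c V t ->
  is_derive t 1 (coordV C c V)
    (- chris g C (cmap C (c t)) (coordV C c (derive1 c) t) (coordV C c V t)).
Proof.
move=> [_ dV cov0]; apply: DeriveDef => //; rewrite -derive1E.
apply/rowP => k; move: cov0 => /rowP/(_ k); rewrite !mxE => /eqP.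
by rewrite addr_eq0 => /eqP.
Qed.

(** Each time comes with its own chart, but the squared speed is independent of charts; its
    derivative can therefore be computed locally, and constancy on [0, 1] follows without gluing
    charts. *)
Lemma geodesic_speed_derive c (t : R) : geodesic m M g c -> 0 <= t <= 1 ->
  is_derive t 1 (fun s => g (c s) (derive1 c s) (derive1 c s)) 0.
Proof.
move=> gc t01; have [C Cct pc] := gc t t01.
have [nMC _ dc _ _] := parallel_at_curve pc.
have dV := parallel_at_derive pc.
have [Mct _] := nbhs_singleton nMC.
have := gform_geodesic_derive hg (crange_cmap Mct Cct) dc dV.
apply: near_eq_is_derive; have [H _ _] := pc.
by apply: filterS H => s [Ms Cs _ ts]; rewrite (metric_chartE hg Ms Cs).
Qed.

Lemma geodesic_speed c (t : R) : geodesic m M g c -> 0 <= t <= 1 ->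
  g (c t) (derive1 c t) (derive1 c t) = g (c 0) (derive1 c 0) (derive1 c 0).
Proof.
move=> gc /andP[t0 t1].
have := @mean_value_le R (fun s => g (c s) (derive1 c s) (derive1 c s)) (cst 0)
  0 t 0 t0.
rewrite mul0r normr_le0 subr_eq0 => H; apply/eqP/H => s /andP[s0 st].
  by apply: geodesic_speed_derive => //; rewrite s0 (le_trans st).
by rewrite normr0.
Qed.

(** Used in both directions: the initial velocity controls the length of a constructed geodesic, and
    the length of a given geodesic controls its speed at all times. *)
Lemma geodesic_length c : geodesic m M g c ->
  curve_length g c = rnorm g (c 0) (derive1 c 0).
Proof.
move=> gc; rewrite /curve_length /rnorm.
rewrite (@eq_Rintegral _ _ _ _ _ (cst (rnorm g (c 0) (derive1 c 0)))); last first.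
  by move=> t; rewrite inE/= in_itv/= => t01; rewrite geodesic_speed.
rewrite Rintegral_cst; last exact: measurable_itv.
have -> : fine (lebesgue_measure `[0 : R, 1]%classic) = 1.
  by have := @lebesgue_measure_itv R `[0, 1]%R; rewrite /= lte_fin ltr01 oppr0 adde0 => ->.
by rewrite mulr1.
Qed.

End GeodesicSpeed.

(** * The geodesic boundary value problem *)

Lemma geometric_small (R : realType) (B e : R) :
  0 < e -> exists k : nat, B / 2 ^+ k < e.
Proof.
move=> e0; have : geometric B 2^-1 @ \oo --> (0 : R).
  by apply: cvg_geometric; rewrite ger0_norm ?invr_ge0// invf_lt1// ltr1n.
move=> /cvgrPdist_lt/(_ e e0)[k _ /(_ k (leqnn _))]; rewrite sub0r normrN /= => Hk.
by exists k; rewrite -exprVn; apply: le_lt_trans Hk; exact: ler_norm.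
Qed.

Lemma geometric_pointwise_limit (R : realType) (m : nat) (u : nat -> R -> 'rV[R]_m)
    (B : R) :
  (forall k t, `|u k.+1 t - u k t| <= B / 2 ^+ k) ->
  exists p : R -> 'rV[R]_m, forall k t, `|u k t - p t| <= 2 * B / 2 ^+ k.
Proof.
move=> Hu.
have B0 : 0 <= B by have := le_trans (normr_ge0 _) (Hu 0%N 0); rewrite expr0 divr1.
have Hd k j t : `|u (k + j)%N t - u k t| <= 2 * B / 2 ^+ k - 2 * B / 2 ^+ (k + j).
  elim: j => [|j IH]; first by rewrite addn0 !subrr normr0.
  rewrite addnS (le_trans (ler_distD (u (k + j)%N t) _ _))//.
  rewrite (le_trans (lerD (Hu (k + j)%N t) IH))//.
  rewrite exprS invfM.
  have -> : 2 * B * (2^-1 * (2 ^+ (k + j))^-1) = B / 2 ^+ (k + j).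
    by rewrite mulrACA mulfV// mul1r.
  by rewrite -[2 * B]/((1 + 1) * B) mulrDl mul1r; lra.
have Hd2 k j t : (k <= j)%N -> `|u j t - u k t| <= 2 * B / 2 ^+ k.
  move=> kj; rewrite -(subnKC kj) (le_trans (Hd _ _ _))// gerBl//.
  by rewrite divr_ge0 ?mulr_ge0// exprn_ge0.
have cu t : cvg (u k t @[k --> \oo]).
  apply/cauchy_cvgP; apply: cauchy_exP => e e0.
  have [k Hk] := geometric_small (2 * B) e0.
  exists (u k t); exists k => // j /= kj.
  rewrite -ball_normE /ball_/= distrC; exact: le_lt_trans (Hd2 _ _ _ kj) Hk.
exists (fun t => lim (u k t @[k --> \oo])) => k t; apply/ler_addgt0Pr => e e0.
have /cvgrPdist_lt/(_ e e0)[N _ HN] := cu t.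
have := HN (N + k)%N (leq_addr _ _) => /= h.
rewrite (le_trans (ler_distD (u (N + k)%N t) _ _))// lerD//.
  by rewrite distrC Hd2// leq_addl.
by rewrite distrC ltW.
Qed.

(** A contraction of ratio 1/2 on a set [Q] of functions closed under uniform limits. [B] bounds the
    first increment, so the iterates converge geometrically, uniformly in time. *)
Lemma picard (R : realType) (m : nat) (T : (R -> 'rV[R]_m) -> R -> 'rV[R]_m)
    (Q : (R -> 'rV[R]_m) -> Prop) (p0 : R -> 'rV[R]_m) (B : R) :
  Q p0 -> (forall p, Q p -> Q (T p)) ->
  (forall (u : nat -> R -> 'rV[R]_m) p, (forall k, Q (u k)) ->
     (forall e : R, 0 < e -> exists k, forall t, `|u k t - p t| < e) -> Q p) ->
  (forall p q (D : R), Q p -> Q q -> (forall t, `|p t - q t| <= D) ->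
     forall t, `|T p t - T q t| <= D / 2) ->
  (forall t, `|T p0 t - p0 t| <= B) ->
  exists2 p, Q p & forall t, T p t = p t.
Proof.
move=> Q0 QT Qlim Tc TB.
pose u k := iter k T p0.
have Qu k : Q (u k) by elim: k => //= k; exact: QT.
have Hu k t : `|u k.+1 t - u k t| <= B / 2 ^+ k.
  elim: k t => [|k IH] t; first by rewrite expr0 divr1; exact: TB.
  by rewrite exprSr invfM mulrA; exact: (Tc (u k.+1) (u k) _ (Qu _) (Qu _) IH t).
have [p Hp] := geometric_pointwise_limit Hu.
have B0 : 0 <= B by apply: le_trans (TB 0).
have Qp : Q p.
  apply: (Qlim u) => // e /(geometric_small (2 * B))[k Hk]; exists k => t.
  exact: le_lt_trans (Hp k t) Hk.
exists p => // t; apply/eqP; rewrite -subr_eq0 -normr_le0; apply/ler_addgt0Pr => e e0.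
rewrite add0r.
have e20 : 0 < e / 2 by rewrite divr_gt0.
have [k Hk] := geometric_small (2 * B) e20.
rewrite (le_trans (ler_distD (u k.+1 t) _ _))// (splitr e) lerD//.
  rewrite distrC (le_trans (Tc _ _ _ (Qu k) Qp (Hp k) t))//.
  rewrite (le_trans _ (ltW Hk))// ler_pdivrMr// ler_peMr ?ler1n//.
  by rewrite divr_ge0 ?mulr_ge0// exprn_ge0.
rewrite (le_trans (Hp k.+1 t))// (le_trans _ (ltW Hk))// ler_wpM2l ?mulr_ge0//.
by rewrite lef_pV2 ?posrE ?exprn_gt0// exprS ler_peMl ?exprn_ge0// ler1n.
Qed.

(** The interval [-2, 3] leaves room around [-1, 2], so that derivatives at -1 and 2 are two-sided;
    [-1, 2] in turn leaves room around [0, 1], as [parallel_at] constrains a neighbourhood of each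
    time. *)
Lemma antiderivative (R : realType) (q : R -> R) : continuous q ->
  exists F : R -> R, F 0 = 0 /\
    forall t : R, -2 < t < 3 -> is_derive t 1 F (q t).
Proof.
move=> cq; pose F (x : R) := (\int[lebesgue_measure]_(t in `[(-2 : R), x]) q t)%R.
have intq : lebesgue_measure.-integrable `[(-2 : R), 3] (EFin \o q).
  apply: continuous_compact_integrable; first exact: segment_compact.
  exact: continuous_subspaceT.
exists (fun x => F x - F 0); split=> [|t /andP[t2 t3]]; first by rewrite subrr.
have [dF DF] := continuous_FTC1_closed t3 intq t2 (cq t).
rewrite -[q t]subr0; apply: is_deriveB.
by apply: DeriveDef; rewrite -?derive1E.
Qed.

Lemma antiderivative_rV (R : realType) (m : nat) (q : R -> 'rV[R]_m) :
  continuous q -> exists F : R -> 'rV[R]_m, F 0 = 0 /\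
    forall t : R, -2 < t < 3 -> is_derive t 1 F (q t).
Proof.
move=> cq; have cqi i : continuous (fun t => q t 0 i).
  by move=> t; apply: continuous_comp (cq t) (@coord_continuous _ _ _ 0 i _).
have [F HF] := choice (fun i => antiderivative (cqi i)).
exists (fun t => \row_i F i t); split.
  by apply/rowP => i; rewrite !mxE; have [] := HF i.
move=> t t23; apply/is_derive_coordP => i.
under eq_fun do rewrite mxE.
by have [_] := HF i; apply.
Qed.

Definition clamp {R : realType} (t : R) := Num.max (-1) (Num.min t 2).

Lemma clamp_bounds (R : realType) (t : R) : -1 <= clamp t <= 2.
Proof.
rewrite /clamp; apply/andP; split; first by rewrite le_max lexx.
by rewrite ge_max ge_min lexx orbT andbT; lra.
Qed.

Lemma clamp_id (R : realType) (t : R) : -1 <= t <= 2 -> clamp t = t.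
Proof. by move=> /andP[t1 t2]; rewrite /clamp (min_idPl t2) (max_idPr t1). Qed.

Lemma clampE (R : realType) (t : R) :
  clamp t = if t <= -1 then -1 else if t <= 2 then t else 2.
Proof.
rewrite /clamp; have [t1|t1] := leP t (-1).
  by rewrite max_l// ge_min t1.
by have [t2|t2] := leP t 2; rewrite max_r//; lra.
Qed.

Lemma clamp_lipschitz (R : realType) (s t : R) : `|clamp s - clamp t| <= `|s - t|.
Proof.
have H (x y : R) : x <= y -> `|clamp x - clamp y| <= `|x - y|.
  move=> xy; rewrite distrC [leRHS]distrC [leRHS]ger0_norm ?subr_ge0//.
  rewrite !clampE ger0_norm; case: (leP x (-1)) => ?; case: (leP y (-1)) => ?;
    case: (leP x 2) => ?; case: (leP y 2) => ?; lra.
by have [/H//|/ltW/H] := leP s t; rewrite distrC [`|t - s|]distrC.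
Qed.

Section Integral.
Context {R : realType} {m : nat}.
Implicit Types q : R -> 'rV[R]_m.

(* An antiderivative on [-1, 2], extended by constants; the functions fed to
   the Picard iteration are thus continuous and bounded on the whole line. *)
Definition iprim q : R -> 'rV[R]_m :=
  xget (fun=> 0) [set F | F 0 = 0 /\ forall t : R, -2 < t < 3 -> is_derive t 1 F (q t)]
  \o clamp.

Lemma iprim_spec q : continuous q -> exists F, [/\ F 0 = 0,
  forall t : R, -2 < t < 3 -> is_derive t 1 F (q t) & iprim q = F \o clamp].
Proof.
move=> /antiderivative_rV H; have [F0 dF] := xgetPex (fun=> 0) H.
by eexists; split; [exact: F0|exact: dF|].
Qed.

Lemma iprim0 q : continuous q -> iprim q 0 = 0.
Proof.
move=> /iprim_spec[F [F0 _ ->]]; rewrite /= clamp_id ?F0//; lra.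
Qed.

Lemma iprim_derive q (t : R) : continuous q -> -1 < t < 2 ->
  is_derive t 1 (iprim q) (q t).
Proof.
move=> /iprim_spec[F [_ dF ->]] /andP[t1 t2].
have dFt : is_derive t 1 F (q t) by apply: dF; lra.
apply: near_eq_is_derive dFt; near=> s => /=; rewrite clamp_id//.
apply/andP; split; apply: ltW.
  by near: s; exact: lt_nbhsr.
by near: s; exact: lt_nbhsl.
Unshelve. all: by end_near. Qed.

(** The factor 2 is the largest distance from 0, where the antiderivatives vanish, to a point of
    [-1, 2]. *)
Lemma iprim_dist q q' (B : R) : continuous q -> continuous q' ->
  (forall s, `|q s - q' s| <= B) ->
  forall t, `|iprim q t - iprim q' t| <= 2 * B.
Proof.
move=> /iprim_spec[F [F0 dF ->]] /iprim_spec[G [G0 dG ->]] qB t /=.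
have B0 : 0 <= B by apply: le_trans (qB 0).
have /andP[] := clamp_bounds t; move: (clamp t) => s s1 s2.
have dFG (r : R) : -1 <= r <= 2 -> is_derive r 1 (fun r => F r - G r) (q r - q' r).
  by move=> /andP[r1 r2]; apply: is_deriveB; [apply: dF|apply: dG]; lra.
have FG0 : F 0 - G 0 = 0 by rewrite F0 G0 subrr.
have [s0|/ltW s0] := leP 0 s.
  have := @mean_value_le_rV R m (fun r => F r - G r) (fun r => q r - q' r) 0 s B s0.
  rewrite FG0 !subr0 => H; rewrite (le_trans (H _ _))//.
    by move=> r /andP[r0 rs]; apply: dFG; lra.
  by rewrite mulrC ler_wpM2r.
have := @mean_value_le_rV R m (fun r => F r - G r) (fun r => q r - q' r) s 0 B s0.
rewrite FG0 !sub0r normrN => H; rewrite (le_trans (H _ _))//.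
  by move=> r /andP[r0 rs]; apply: dFG; lra.
by rewrite mulrC ler_wpM2r//; lra.
Qed.

Lemma iprim_cst0 t : iprim (fun=> 0 : 'rV[R]_m) t = 0.
Proof.
have [|F [F0 dF ->]] := @iprim_spec (fun=> 0); first by move=> s; exact: cst_continuous.
move=> /=; have /andP[] := clamp_bounds t; move: (clamp t) => s s1 s2.
have dF' (r : R) : -1 <= r <= 2 -> is_derive r 1 F 0 by move=> ?; apply: dF; lra.
apply/eqP; rewrite -normr_le0.
have [s0|/ltW s0] := leP 0 s.
  have := @mean_value_le_rV R m F (fun=> 0) 0 s 0 s0.
  rewrite F0 !subr0 mul0r; apply=> r /andP[r0 rs]; last by rewrite normr0.
  by apply: dF'; lra.
have := @mean_value_le_rV R m F (fun=> 0) s 0 0 s0.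
rewrite F0 !sub0r mul0r normrN; apply=> r /andP[r0 rs]; last by rewrite normr0.
by apply: dF'; lra.
Qed.

Lemma iprim_norm q (B : R) : continuous q -> (forall s, `|q s| <= B) ->
  forall t, `|iprim q t| <= 2 * B.
Proof.
move=> cq qB t; have c0 : continuous (fun _ : R => 0 : 'rV[R]_m).
  by move=> s; exact: cst_continuous.
have := @iprim_dist q (fun=> 0) B cq c0 _ t.
by rewrite iprim_cst0 subr0; apply=> s; rewrite subr0.
Qed.

Lemma iprim_continuous q : continuous q -> continuous (iprim q).
Proof.
move=> /iprim_spec[F [_ dF ->]] t; apply: continuous_comp; last first.
  by have /andP[? ?] := clamp_bounds t; apply: (is_derive_cont (dF _ _)); lra.
apply/continuous_atP => e e0; exists e => // s; apply: le_lt_trans.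
exact: clamp_lipschitz.
Qed.

End Integral.

(* A fixed point problem for p = c'; unlike shooting, it does not require the
   differentiability of solutions with respect to initial data. *)
Lemma boundary_value_problem (R : realType) (m : nat)
    (N : 'rV[R]_m -> 'rV[R]_m -> 'rV[R]_m) (u0 : 'rV[R]_m) (r K : R) :
  0 < r -> 0 <= K ->
  (forall u X : 'rV[R]_m, `|u - u0| < r -> `|N u X| <= K * `|X| * `|X|) ->
  (forall u v X Y : 'rV[R]_m, `|u - u0| < r -> `|v - u0| < r ->
    `|N u X - N v Y| <= K * `|u - v| * `|X| * `|X| + K * `|X - Y| * (`|X| + `|Y|)) ->
  exists2 rho : R, 0 < rho & forall u v : 'rV[R]_m, `|u - u0| < rho -> `|v - u0| < rho ->
    exists c p : R -> 'rV[R]_m, [/\ c 0 = u, c 1 = v &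
      forall t : R, -1 < t < 2 -> [/\ is_derive t 1 c (p t),
        is_derive t 1 p (N (c t) (p t)), `|c t - u0| < r & `|p t| <= 2 * `|v - u|]].
Proof.
move=> r0 K0 HN1 HN2.
(* Let de = |v - u| < 2 rho. Velocities bounded by 2 de on [-1, 2] keep the curve within rho + 4 de
   < 9 rho of [u0], whence r / 9. The bound 1/2 gives de <= 1, and the last one K de <= 1/150: the
   operator [T] below has Lipschitz constant at most 72 K de and moves away from v - u by at most 24
   K de^2. *)
pose rho := Num.min (1 / 2) (Num.min (r / 9) (1 / (300 * (K + 1)))).
have K1 : 0 < 300 * (K + 1) by lra.
have rho0 : 0 < rho by rewrite !lt_min !divr_gt0.
exists rho => // u v uu0 vu0; set de := `|v - u|.
have de0 : 0 <= de by exact: normr_ge0.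
have de2 : de < 2 * rho.
  rewrite /de (le_lt_trans (ler_distD u0 _ _))// -[2]/(1 + 1) mulrDl mul1r ltrD//.
  by rewrite distrC.
have rho1 : rho <= 1 / 2 by rewrite ge_min lexx.
have rho2 : rho <= r / 9 by rewrite !ge_min lexx orbT.
have rho3 : rho * (300 * (K + 1)) <= 1.
  by rewrite -ler_pdivlMr// !ge_min lexx !orbT.
have de1 : de <= 1 by lra.
have Kde : 150 * (K * de) <= 1.
  have h1 : K * de <= K * (2 * rho) by rewrite ler_wpM2l// ltW.
  by lra.
have Kde0 : 0 <= K * de by rewrite mulr_ge0.
have Kdd : K * de * de <= K * de by rewrite ler_piMr.
have Kdd2 : 150 * (K * de * de) <= de.
  by rewrite mulrA -[leRHS]mul1r ler_wpM2r.
have Kdd0 : 0 <= K * de * de by rewrite mulr_ge0.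
pose Q (p : R -> 'rV[R]_m) := continuous p /\ forall t, `|p t| <= 2 * de.
pose cc (p : R -> 'rV[R]_m) t := u + iprim p t.
pose qq (p : R -> 'rV[R]_m) t := N (cc p t) (p t).
(* For p = c', the equation p' = N(c, p) integrates to p(t) = p(0) + int_0^t N, and c(1) = v forces
   p(0) = v - u - int_0^1 int_0^s N, the double [iprim] at time 1. *)
pose T (p : R -> 'rV[R]_m) t :=
  (v - u) + (iprim (qq p) t - iprim (iprim (qq p)) 1).
have ccr p t : Q p -> `|cc p t - u0| < r.
  move=> [cp pd]; rewrite /cc addrAC (le_lt_trans (ler_normD _ _))//.
  have := iprim_norm cp pd t; lra.
have ccc p : Q p -> continuous (cc p).
  move=> [cp _] t; apply: continuousD; first exact: cst_continuous.
  exact: iprim_continuous.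
have qqd p p' t s : Q p -> Q p' -> `|qq p t - qq p' s| <=
    4 * (K * de * de) * `|cc p t - cc p' s| + 4 * (K * de) * `|p t - p' s|.
  move=> Qp Qp'; rewrite (le_trans (HN2 _ _ _ _ (ccr _ _ Qp) (ccr _ _ Qp')))//.
  have [_ pd] := Qp; have [_ pd'] := Qp'.
  have h0 : 0 <= `|p t| by exact: normr_ge0.
  apply: lerD.
    have -> : 4 * (K * de * de) * `|cc p t - cc p' s| =
      K * `|cc p t - cc p' s| * (2 * de) * (2 * de) by ring.
    by rewrite !ler_pM ?mulr_ge0.
  have -> : 4 * (K * de) * `|p t - p' s| = K * `|p t - p' s| * (2 * de + 2 * de) by ring.
  by rewrite ler_wpM2l ?mulr_ge0// lerD.
have qqc p : Q p -> continuous (qq p).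
  move=> Qp t; apply/continuous_atP => e e0.
  have [cp _] := Qp.
  have e2 : 0 < e / 2 by rewrite divr_gt0.
  have [d1 d10 H1] := (continuous_atP _ _).1 (ccc _ Qp t) _ e2.
  have [d2 d20 H2] := (continuous_atP _ _).1 (cp t) _ e2.
  exists (Num.min d1 d2); first by rewrite lt_min d10.
  move=> s; rewrite lt_min => /andP[/H1 h1 /H2 h2].
  rewrite (le_lt_trans (qqd _ _ _ _ Qp Qp))//.
  have i1 : 4 * (K * de * de) * `|cc p s - cc p t| <= 1 * `|cc p s - cc p t|.
    by rewrite ler_wpM2r//; lra.
  have i2 : 4 * (K * de) * `|p s - p t| <= 1 * `|p s - p t|.
    by rewrite ler_wpM2r//; lra.
  lra.
have qqn p s : Q p -> `|qq p s| <= 4 * (K * de * de).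
  move=> Qp; have [_ pd] := Qp; rewrite (le_trans (HN1 _ _ (ccr _ _ Qp)))//.
  have -> : 4 * (K * de * de) = K * (2 * de) * (2 * de) by ring.
  by rewrite !ler_pM ?mulr_ge0.
have iqc p : Q p -> continuous (iprim (qq p)) by move=> /qqc; exact: iprim_continuous.
have Tn p t : Q p -> `|T p t - (v - u)| <= de.
  move=> Qp; rewrite /T addrC addKr (le_trans (ler_normB _ _))//.
  have n1 s := iprim_norm (qqc _ Qp) (qqn p ^~ Qp) s.
  have n2 := iprim_norm (iqc _ Qp) n1 1.
  have := n1 t; lra.
have Q0 : Q (fun=> v - u).
  by split=> [t|t]; [exact: cst_continuous|rewrite ler_peMl// ler1n].
have QT p : Q p -> Q (T p).
  move=> Qp; split=> t; last first.
    rewrite -(subrK (v - u) (T p t)) (le_trans (ler_normD _ _))//.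
    by have := Tn p t Qp; rewrite -/de; lra.
  apply: cvgD; first exact: cvg_cst.
  by apply: cvgB; [exact: iqc|exact: cvg_cst].
have Qlim (w : nat -> R -> 'rV[R]_m) p : (forall k, Q (w k)) ->
    (forall e : R, 0 < e -> exists k, forall t, `|w k t - p t| < e) -> Q p.
  move=> Qw wp; split=> t.
    apply/continuous_atP => e e0; have e3 : 0 < e / 3 by rewrite divr_gt0.
    have [k Hk] := wp _ e3.
    have [d d0 Hd] := (continuous_atP _ _).1 ((Qw k).1 t) _ e3.
    exists d => // s /Hd h.
    rewrite (le_lt_trans (ler_distD (w k s) _ _))//.
    rewrite [`|p s - _|]distrC.
    have := ler_distD (w k t) (w k s) (p t).
    have := Hk s; have := Hk t; lra.
  apply/ler_addgt0Pr => e /wp[k Hk].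
  rewrite -(subrK (w k t) (p t)) (le_trans (ler_normD _ _))// distrC addrC.
  by apply: lerD; [exact: (Qw k).2|exact/ltW/Hk].
have Tc p p' (D : R) : Q p -> Q p' -> (forall t, `|p t - p' t| <= D) ->
     forall t, `|T p t - T p' t| <= D / 2.
  move=> Qp Qp' pD t.
  have D0 : 0 <= D by apply: le_trans (pD 0).
  have cd s : `|cc p s - cc p' s| <= 2 * D.
    rewrite /cc opprD addrACA subrr add0r.
    by apply: iprim_dist pD s; [exact: Qp.1|exact: Qp'.1].
  have qd s : `|qq p s - qq p' s| <= 12 * (K * de) * D.
    rewrite (le_trans (qqd _ _ _ _ Qp Qp'))//.
    have i1 : 4 * (K * de * de) * `|cc p s - cc p' s| <= 4 * (K * de) * (2 * D).
      by rewrite ler_pM ?mulr_ge0// ler_wpM2l.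
    have i2 : 4 * (K * de) * `|p s - p' s| <= 4 * (K * de) * D.
      by rewrite ler_wpM2l ?mulr_ge0.
    lra.
  have n1 s := iprim_dist (qqc _ Qp) (qqc _ Qp') qd s.
  have n2 := iprim_dist (iqc _ Qp) (iqc _ Qp') n1 1.
  have -> : T p t - T p' t = (iprim (qq p) t - iprim (qq p') t)
     - (iprim (iprim (qq p)) 1 - iprim (iprim (qq p')) 1).
    by rewrite /T opprD addrACA subrr add0r !opprD !opprK addrACA.
  rewrite (le_trans (ler_normB _ _))//.
  have KD : 150 * (K * de) * D <= 1 * D by rewrite ler_wpM2r.
  have := n1 t; lra.
have [p Qp pT] := @picard R m T Q (fun=> v - u) de Q0 QT Qlim Tc
  (fun t => Tn _ t Q0).
have [cp pd] := Qp.
have pE : p = T p by apply/funext => t; rewrite pT.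
have dp (t : R) : -1 < t < 2 -> is_derive t 1 p (qq p t).
  move=> t12; rewrite {1}pE -[qq p t]add0r -[qq p t]subr0.
  apply: is_deriveD; apply: is_deriveB.
  exact: iprim_derive (qqc _ Qp) t12.
have dc (t : R) : -1 < t < 2 -> is_derive t 1 (cc p) (p t).
  move=> t12; rewrite -[p t]add0r; apply: is_deriveD.
  exact: iprim_derive cp t12.
exists (cc p), p; split.
- by rewrite /cc iprim0// addr0.
(* The fixed point equation integrates to an explicit formula for [cc p]: the two sides agree at 0
   and have the same derivative. At time 1 the terms in [A] cancel, leaving [v]. *)
- pose A := iprim (iprim (qq p)) 1.
  have := @mean_value_le_rV R m
    (fun s => cc p s - (u + s *: (v - u - A) + iprim (iprim (qq p)) s))
    (fun=> 0) 0 1 0 ler01.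
  rewrite mul0r scale0r scale1r addr0 /cc !iprim0//; last exact: iqc.
  rewrite !addr0 subrr subr0 -/A addrA subrK [u + (v - u)]addrC subrK.
  move=> H; apply/eqP; rewrite -subr_eq0 -normr_le0.
  apply: H => s s01; last by rewrite normr0.
  have s12 : -1 < s < 2 by move: s01 => /andP[]; lra.
  have -> : 0 = p s - (v - u - A + iprim (qq p) s).
    apply/esym/eqP; rewrite subr_eq0 -(pT s) /T -/A -[X in _ == X]addrA.
    by rewrite [- A + _]addrC.
  apply: is_deriveB; first exact: dc.
  apply: is_deriveD; last exact: iprim_derive (iqc _ Qp) s12.
  exact: is_derive_line.
- move=> t t12; split; [exact: dc|exact: dp|exact: ccr|exact: pd].
Qed.

(** * Short geodesics *)

Section ShortGeodesics.
Context {R : realType} {n m : nat} {M : set 'rV[R]_n}.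
Context (g : 'rV[R]_n -> 'rV[R]_n -> 'rV[R]_n -> R).
Hypothesis hg : riemannian_metric m M g.
Implicit Types (C : chart m M).

Lemma dchart_cinv C u a : crange C u -> dchart C (cinv C u) ('d (cinv C) u a) = a.
Proof.
move=> Cu; have [Mu Du] := crange_cinv Cu.
by have := dchart_d a Mu Du; rewrite cinvK.
Qed.

Lemma chrisB C v (X Y : 'rV[R]_m) :
  chris g C v X X - chris g C v Y Y = chris g C v (X - Y) X + chris g C v Y (X - Y).
Proof.
apply/rowP => k; rewrite !mxE -sumrB -big_split; apply: eq_bigr => i _ /=.
rewrite -sumrB -big_split; apply: eq_bigr => j _ /=; rewrite !mxE.
by rewrite !(mulrBl, mulrBr) addrA subrK.
Qed.

Lemma geodesic_of_coords C (c p : R -> 'rV[R]_m) :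
  (forall t : R, -1 < t < 2 -> [/\ is_derive t 1 c (p t),
     is_derive t 1 p (- chris g C (c t) (p t) (p t)) & crange C (c t)]) ->
  geodesic m M g (cinv C \o c).
Proof.
move=> H t /andP[t0 t1].
have t12 : -1 < t < 2 by lra.
have near12 : \forall s \near t, -1 < s < 2.
  have : \forall s \near t, s \in `]-1, 2[%R by apply: near_in_itvoo; rewrite in_itv.
  by apply: filterS => s; rewrite in_itv.
have dcc (s : R) : -1 < s < 2 ->
    is_derive s 1 (cinv C \o c) ('d (cinv C) (c s) (p s)).
  by move=> /H[dc _ Cs]; apply: is_derive_comp_diff => //; exact: cinv_diff.
have dccE s : -1 < s < 2 -> derive1 (cinv C \o c) s = 'd (cinv C) (c s) (p s).
  by move=> /dcc[_]; rewrite derive1E.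
have nV : \forall s \near t, p s = coordV C (cinv C \o c) (derive1 (cinv C \o c)) s.
  apply: filterS near12 => s s12; have [_ _ Cs] := H _ s12.
  by rewrite /coordV /= dccE// dchart_cinv.
have [dc dp Ct] := H _ t12; have [Mt Dt] := crange_cinv Ct.
have dV := near_eq_is_derive nV dp.
exists C => //; split.
- apply: filterS near12 => s s12; have [_ _ Cs] := H _ s12.
  have [Ms Ds] := crange_cinv Cs.
  split=> //; first by have [] := dcc _ s12.
  by rewrite dccE//; exact: tangent_d.
- by case: dV.
- apply/rowP => k; rewrite !mxE; case: dV => _; rewrite -derive1E => ->.
  rewrite /= cinvK// -(nbhs_singleton nV) !mxE addNr.
  by [].
Qed.

Lemma short_geodesic C u0 : crange C u0 -> exists rho k : R, [/\ 0 < rho, 0 <= k &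
  forall u v : 'rV[R]_m, `|u - u0| < rho -> `|v - u0| < rho -> exists c,
    geodesic_between m M g c (cinv C u) (cinv C v) /\
    curve_length g c <= k * `|v - u|].
Proof.
move=> Cu0.
have [r1 [c1 [c2 [r10 c10 c20 H1]]]] := metric_bounds hg Cu0.
have [r2 [K [r20 K0 H2]]] := chris_bounds hg Cu0.
pose r := Num.min r1 r2; have r0 : 0 < r by rewrite lt_min r10.
(* The right-hand side is quadratic in the velocity: a difference of two values is split first in
   the point, then by bilinearity in the vector. *)
have [||rho rho0 H] := @boundary_value_problem R m
  (fun u X => - chris g C u X X) u0 r K r0 K0.
- move=> u X; rewrite lt_min => /andP[ur1 ur2]; rewrite normrN.
  by have [] := H2 u u X X ur2 ur2.
- move=> u v X Y; rewrite !lt_min => /andP[ur1 ur2] /andP[vr1 vr2].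
  rewrite -opprD normrN.
  have [_ h1] := H2 u v X X ur2 vr2.
  have [h2 _] := H2 v v (X - Y) X vr2 vr2.
  have [h3 _] := H2 v v Y (X - Y) vr2 vr2.
  rewrite (le_trans (ler_distD (chris g C v X X) _ _))// lerD//.
  rewrite chrisB (le_trans (ler_normD _ _))// mulrDr lerD//.
  by rewrite (le_trans h3)// mulrAC.
(* [c2] converts the initial coordinate velocity, which is at most 2 |v - u|, into a speed. *)
exists (Num.min rho r), (c2 * 2).
split; [by rewrite lt_min rho0|by rewrite mulr_ge0 ?(ltW c20)|].
move=> u v; rewrite !lt_min => /andP[ur /andP[ur1 _]] /andP[vr _].
have [c [p [cu cv Hc]]] := H u v ur vr.
exists (cinv C \o c).
have gc : geodesic m M g (cinv C \o c).
  apply: (@geodesic_of_coords C c p) => t /Hc[dc dp + _].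
  rewrite lt_min => /andP[ctr1 _]; split=> //; by have [] := H1 _ ctr1.
split; first by split=> //=; rewrite ?cu ?cv.
rewrite (geodesic_length hg gc).
have t0 : -1 < (0 : R) < 2 by lra.
have [dc _ _ pn] := Hc 0 t0.
have Cu : crange C u by have [] := H1 _ ur1.
have d0 : is_derive (0 : R) 1 (cinv C \o c) ('d (cinv C) (c 0) (p 0)).
  by apply: is_derive_comp_diff => //; rewrite cu; exact: cinv_diff.
case: d0 => _; rewrite -derive1E => -> /=; rewrite cu.
have [_ /(_ (p 0))/andP[_ h]] := H1 _ ur1.
by rewrite (le_trans h)// -mulrA ler_wpM2l// ltW.
Qed.

End ShortGeodesics.

(** * Geodesics that are short stay in a chart *)

Section GeodesicLocalization.
Context {R : realType} {n m : nat} {M : set 'rV[R]_n}.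
Context (g : 'rV[R]_n -> 'rV[R]_n -> 'rV[R]_n -> R).
Hypothesis hg : riemannian_metric m M g.
Implicit Types (C : chart m M) (c V : R -> 'rV[R]_n).

Lemma curve_length_ge0 c : geodesic m M g c -> 0 <= curve_length g c.
Proof. by move=> gc; rewrite (geodesic_length hg gc) sqrtr_ge0. Qed.

Lemma geodesic_manifold c (t : R) : geodesic m M g c -> 0 <= t <= 1 -> M (c t).
Proof.
move=> gc t01; have [C _ /parallel_at_curve[H _ _ _ _]] := gc _ t01.
by have [] := nbhs_singleton H.
Qed.

Lemma geodesic_continuous c (t : R) :
  geodesic m M g c -> 0 <= t <= 1 -> {for t, continuous c}.
Proof. by move=> gc t01; have [C _ /parallel_at_curve[]] := gc _ t01. Qed.

Lemma geodesic_chart_derive C c (t : R) : geodesic m M g c -> 0 <= t <= 1 ->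
  cdom C (c t) -> exists2 a, is_derive t 1 (cmap C \o c) a &
    rnorm g (c t) ('d (cinv C) (cmap C (c t)) a) = curve_length g c.
Proof.
move=> gc t01 Ct; have [C' _ [H _ _]] := gc _ t01.
have [_ _ dc _] := nbhs_singleton H.
have nM : \forall s \near t, M (c s) by apply: filterS H => s [].
have dc1 : is_derive t 1 c (derive1 c t) by apply: DeriveDef; rewrite ?derive1E.
have [a da aE] := cmap_is_derive dc1 nM Ct.
by exists a => //; rewrite aE (geodesic_length hg gc) /rnorm (geodesic_speed hg gc t01).
Qed.

(** A continuation argument: [T] is the last time up to which the curve stays in the coordinate ball
    of radius [r']. The speed bound holds on the larger ball of radius [r], which leaves room to go
    slightly past [T]; constant speed limits the displacement from [u] to l / c1, which restores the
    bound [r'] and contradicts the choice of [T] unless it is 1. *)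
Lemma geodesic_stays C (u0 u : 'rV[R]_m) (r c1 r' : R) c : 0 < c1 -> r' < r ->
  (forall v : 'rV[R]_m, `|v - u0| < r -> crange C v /\
     forall a, c1 * `|a| <= rnorm g (cinv C v) ('d (cinv C) v a)) ->
  geodesic m M g c -> c 0 = cinv C u ->
  `|u - u0| + curve_length g c / c1 <= r' ->
  forall t : R, 0 <= t <= 1 -> cdom C (c t) /\ `|cmap C (c t) - u0| <= r'.
Proof.
move=> c10 rr' Hr gc c0u ur'.
set l := curve_length g c in ur' *.
have l0 : 0 <= l / c1 by rewrite divr_ge0 ?curve_length_ge0// ltW.
have Cball (v : 'rV[R]_m) : `|v - u0| <= r' -> crange C v.
  by move=> vr'; have [] := Hr v (le_lt_trans vr' rr').
have uu0 : `|u - u0| <= r' by rewrite (le_trans _ ur')// lerDl.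
have Cu := Cball _ uu0.
pose P t := cdom C (c t) /\ `|cmap C (c t) - u0| <= r'.
have P0 : P 0 by rewrite /P c0u cinvK//; have [_ ?] := crange_cinv Cu.
pose E := [set t : R | 0 <= t <= 1 /\ forall s, 0 <= s <= t -> P s].
have E0 : E 0.
  split; first by rewrite lexx ler01.
  by move=> s; rewrite -eq_le => /eqP <-.
have supE : has_sup E.
  by split; [exists 0|exists 1 => t [/andP[]]].
pose T := sup E.
have T0 : 0 <= T by apply: (sup_upper_bound supE).
have T1 : T <= 1 by apply: sup_le_ub; [exists 0|move=> t [/andP[]]].
have ltT s : 0 <= s -> s < T -> P s.
  move=> s0 sT; have [t [_ Et] st] := sup_gt (ex_intro _ 0 E0) sT.
  by apply: Et; rewrite s0 ltW.
have T01 : 0 <= T <= 1 by rewrite T0.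
pose K := [set v : 'rV[R]_m | `|v - u0| <= r'].
have cK : compact K.
  apply: bounded_closed_compact.
    exists (`|u0| + r'); split; first exact: num_real.
    move=> y yb v /= vr; rewrite (le_trans _ (ltW yb))// -(subrK u0 v).
    by rewrite (le_trans (ler_normD _ _))// addrC lerD2l.
  apply: (@closed_comp _ _ (fun v : 'rV[R]_m => `|v - u0|) [set x | x <= r']).
    move=> v _; apply/(@continuous_atP R 'rV[R]_m R) => e e0; exists e => // w.
    apply: le_lt_trans; rewrite (le_trans (ler_dist_dist _ _))//.
    by rewrite opprB addrA subrK.
  exact: closed_le.
(* At time [T] the curve is not yet known to be in the chart. The image of a closed coordinate ball
   is compact, hence closed in R^n, and so contains the limit point. *)
have cloK : closed (cinv C @` K).
  apply: compact_closed; first exact: norm_hausdorff.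
  apply: continuous_compact => //; apply: continuous_in_subspaceT => v.
  by rewrite inE => /Cball Cv; exact/differentiable_continuous/cinv_diff.
have KP t : 0 <= t <= 1 -> (cinv C @` K) (c t) -> P t.
  move=> t01 [v Kv cv]; have Cv := Cball _ Kv; have [_ Dv] := crange_cinv Cv.
  by rewrite /P -cv cinvK.
have PK t : 0 <= t <= 1 -> P t -> (cinv C @` K) (c t).
  move=> t01 [Ct tr]; exists (cmap C (c t)) => //; rewrite cmapK//.
  by split=> //; exact: geodesic_manifold gc t01.
have PT : P T.
  move: T0; rewrite le_eqVlt => /orP[/eqP <- //|Tgt0].
  apply: KP => //; apply: contrapT => nK.
  have oK : open (~` (cinv C @` K)) by rewrite openC.
  have /(geodesic_continuous gc T01) : nbhs (c T) (~` (cinv C @` K)).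
    exact: open_nbhs_nbhs.
  move=> /(@near_ballP R R)[d d0 Hd].
  pose s := Num.max 0 (T - d / 2).
  have d20 : 0 < d / 2 by rewrite divr_gt0.
  have sT : s < T by rewrite gt_max Tgt0 gtrBl.
  have s0 : 0 <= s by rewrite le_max lexx.
  have sd : T - d / 2 <= s by rewrite le_max lexx orbT.
  apply: (Hd s); first by rewrite ltr_norml; lra.
  by apply: PK; [lra|exact: ltT].
have ET : E T.
  split=> // s /andP[s0]; rewrite le_eqVlt => /orP[/eqP -> //|]; exact: ltT.
have [T_eq1|T_neq1] := eqVneq T 1.
  by move=> t t01; apply: ET.2; rewrite T_eq1.
exfalso; have Tlt1 : T < 1 by rewrite lt_neqAle T_neq1.
have [CT Tr] := PT.
have nM : \forall s \near T, M (c s).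
  by have [C' _ /parallel_at_curve[H _ _ _ _]] := gc _ T01; apply: filterS H => s [].
have [nMC cT] := curve_in_chart (geodesic_continuous gc T01) nM CT.
have [d1 d10 H1] := (@near_ballP R R T _).1 nMC.
have rr0 : 0 < r - r' by rewrite subr_gt0.
have [d2 d20 H2] := (continuous_atP _ _).1 cT _ rr0.
pose d := Num.min (1 - T) (Num.min (d1 / 2) (d2 / 2)).
have d0 : 0 < d by rewrite !lt_min subr_gt0 Tlt1 !divr_gt0.
have dT : d <= 1 - T by rewrite ge_min lexx.
have dd1 : d <= d1 / 2 by rewrite !ge_min lexx orbT.
have dd2 : d <= d2 / 2 by rewrite !ge_min lexx !orbT.
(* Past [T], continuity only gives the weaker bound [r], which is enough for estimating the
   coordinate velocity. *)
have Q s : 0 <= s <= T + d -> cdom C (c s) /\ `|cmap C (c s) - u0| < r.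
  move=> /andP[s0 sT]; have [sT'|Ts] := leP s T.
    have [h1 h2] : P s by apply: ET.2; rewrite s0.
    by split=> //; exact: le_lt_trans rr'.
  have sd1 : `|s - T| < d1 by rewrite ger0_norm; lra.
  have sd2 : `|s - T| < d2 by rewrite ger0_norm; lra.
  split; first by have [] := H1 _ sd1.
  have := H2 _ sd2 => /= h; have := ler_distD (cmap C (c T)) (cmap C (c s)) u0.
  lra.
have : E (T + d).
  split; first by rewrite addr_ge0 ?(ltW d0)//=; lra.
  move=> t /andP[t0 tT]; have [Ct tr] := Q t (introT andP (conj t0 tT)).
  split=> //.
  have dcmap (s : R) : 0 <= s <= t ->
      exists a, is_derive s 1 (cmap C \o c) a /\ `|a| <= l / c1.
    move=> /andP[s0 st]; have s01 : 0 <= s <= 1 by lra.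
    have [Cs sr] : cdom C (c s) /\ `|cmap C (c s) - u0| < r by apply: Q; lra.
    have [a da aE] := geodesic_chart_derive gc s01 Cs.
    exists a; split=> //; rewrite ler_pdivlMr// mulrC /l -aE.
    have [_ /(_ a)] := Hr _ sr; rewrite cmapK//.
    by split=> //; exact: geodesic_manifold gc s01.
  pose a (s : R) := xget (0 : 'rV[R]_m)
    [set a | is_derive s 1 (cmap C \o c) a /\ `|a| <= l / c1].
  have aP (s : R) : 0 <= s <= t -> is_derive s 1 (cmap C \o c) (a s) /\ `|a s| <= l / c1.
    by move=> /dcmap; exact: xgetPex.
  have := @mean_value_le_rV R m (cmap C \o c) a 0 t (l / c1) t0.
  rewrite /= c0u cinvK// subr0 => H.
  have := ler_distD u (cmap C (c t)) u0.
  have h : `|cmap C (c t) - u| <= l / c1 * t by apply: H => s /aP[].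
  have ht : l / c1 * t <= l / c1 by rewrite ler_piMr//; lra.
  lra.
move=> /(sup_upper_bound supE); rewrite -/T; lra.
Qed.

End GeodesicLocalization.

(** * Distance and parallel transport in a chart *)

Section ShortestGeodesics.
Context {R : realType} {n m : nat} {M : set 'rV[R]_n}.
Context (g : 'rV[R]_n -> 'rV[R]_n -> 'rV[R]_n -> R).
Context (sigma : 'rV[R]_n -> 'rV[R]_n -> R -> 'rV[R]_n).
Hypothesis hg : riemannian_metric m M g.
Hypothesis hsigma : shortest_geodesics m M g sigma.
Implicit Types (C : chart m M).

Lemma dist_ge0 x y : M x -> M y -> 0 <= dist g sigma x y.
Proof.
by move=> Mx My; have [/(_ x y Mx My)[[+ _ _] _] _] := hsigma; exact: curve_length_ge0.
Qed.

Lemma dist_chart_le C u0 : crange C u0 -> exists rho k : R, [/\ 0 < rho, 0 <= k &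
  forall u v : 'rV[R]_m, `|u - u0| < rho -> `|v - u0| < rho ->
    [/\ crange C u, crange C v & dist g sigma (cinv C u) (cinv C v) <= k * `|u - v| ]].
Proof.
move=> Cu0; have [rho [k [rho0 k0 H]]] := short_geodesic hg Cu0.
have [r r0 Hr] := (@near_ballP R 'rV[R]_m _ _).1 (crange_near Cu0).
exists (Num.min rho r), k; split; rewrite ?lt_min ?rho0// => u v.
rewrite !lt_min => /andP[ur ur2] /andP[vr vr2].
have Cu := Hr _ ur2; have Cv := Hr _ vr2; split=> //.
have [c [gc lc]] := H _ _ ur vr.
rewrite [`|u - v|]distrC; apply: (le_trans _ lc).
have [Mu _] := crange_cinv Cu; have [Mv _] := crange_cinv Cv.
by have [/(_ _ _ Mu Mv)[_ +] _] := hsigma; apply.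
Qed.

Lemma lipschitz_chart (f : 'rV[R]_n -> R) C u0 :
  lipschitz_on_manifold M g sigma f -> crange C u0 -> loc_lip u0 (f \o cinv C).
Proof.
move=> [L HL] Cu0; have [rho [k [rho0 k0 H]]] := dist_chart_le Cu0.
exists rho, (`|L| * k); split=> // [|u v ur vr]; first by rewrite mulr_ge0.
have [Cu Cv duv] := H _ _ ur vr.
have [Mu _] := crange_cinv Cu; have [Mv _] := crange_cinv Cv.
rewrite (le_trans (HL _ _ Mu Mv))//.
apply: (@le_trans _ _ (`|L| * dist g sigma (cinv C u) (cinv C v))).
  by rewrite ler_wpM2r ?dist_ge0// ler_norm.
by rewrite -mulrA ler_wpM2l.
Qed.

(* The coordinates of a parallel field satisfy a linear equation whose
   coefficients are bounded by the length of the geodesic. *)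
Lemma parallel_close C u0 u (r c1 r' K : R) c V : 0 < c1 -> r' < r -> 0 <= K ->
  (forall v : 'rV[R]_m, `|v - u0| < r -> [/\ crange C v,
     forall a, c1 * `|a| <= rnorm g (cinv C v) ('d (cinv C) v a) &
     forall X Y, `|chris g C v X Y| <= K * `|X| * `|Y|]) ->
  geodesic m M g c -> c 0 = cinv C u ->
  `|u - u0| + curve_length g c / c1 <= r' ->
  parallel m M g c V -> K * (curve_length g c / c1) <= 1 / 2 ->
  `|coordV C c V 0 - coordV C c V 1| <=
    2 * (K * (curve_length g c / c1)) * `|coordV C c V 1|.
Proof.
move=> c10 rr' K0 Hr gc c0 ur' pV Kl.
set l := curve_length g c / c1 in ur' Kl *.
have l0 : 0 <= l by rewrite divr_ge0 ?(curve_length_ge0 hg gc)// ltW.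
have Kl0 : 0 <= K * l by exact: mulr_ge0.
have Hr1 (v : 'rV[R]_m) : `|v - u0| < r -> crange C v /\
     forall a, c1 * `|a| <= rnorm g (cinv C v) ('d (cinv C) v a).
  by move=> /Hr[].
have stay := geodesic_stays hg c10 rr' Hr1 gc c0 ur'.
pose psi := coordV C c V.
pose dpsi t := - chris g C (cmap C (c t)) (coordV C c (derive1 c) t) (psi t).
have dpsiP (t : R) : 0 <= t <= 1 -> is_derive t 1 psi (dpsi t).
  by move=> t01; have [Ct _] := stay _ t01; exact: parallel_at_derive (pV t t01 C Ct).
have dpsin (t : R) : 0 <= t <= 1 -> `|dpsi t| <= K * l * `|psi t|.
  move=> t01; have [Ct tr] := stay _ t01.
  have [Cr Hc1 HK] := Hr _ (le_lt_trans tr rr').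
  rewrite normrN (le_trans (HK _ _))// ler_wpM2r// ler_wpM2l//.
  rewrite ler_pdivlMr// mulrC (le_trans (Hc1 _))//.
  have [_ _ _ _ E] := parallel_at_curve (pV t t01 C Ct).
  have Mt := geodesic_manifold gc t01.
  by rewrite E cmapK// /rnorm (geodesic_speed hg gc t01) (geodesic_length hg gc).
have cn : {within `[0, 1], continuous (fun t => `|psi t|)}.
  apply: continuous_in_subspaceT => t; rewrite inE/= in_itv/= => t01.
  apply: continuous_comp; first exact: is_derive_cont (dpsiP t t01).
  exact: norm_continuous.
(* The maximum of |psi| replaces Gronwall's inequality: [psi] moves by at most K l times this
   maximum, and K l <= 1/2 bounds the maximum by twice |psi 1|. Time 1 is the reference because in
   the application the size of the vector is known at that end. *)
have [t0 t001 maxt0] := EVT_max ler01 cn.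
rewrite in_itv/= in t001.
have bound (t : R) : 0 <= t <= 1 -> `|psi 1 - psi t| <= K * l * `|psi t0|.
  move=> /andP[t_ge0 t_le1].
  have := @mean_value_le_rV R m psi dpsi t 1 (K * l * `|psi t0|) t_le1.
  move=> H; rewrite (le_trans (H _ _))//.
  - by move=> s /andP[ts s1]; apply: dpsiP; rewrite s1 (le_trans t_ge0).
  - move=> s /andP[ts s1]; have s01 : 0 <= s <= 1 by rewrite s1 (le_trans t_ge0).
    rewrite (le_trans (dpsin _ s01))// (ler_wpM2l Kl0)//.
    by apply: maxt0; rewrite in_itv.
  - by rewrite ler_piMr ?gerBl// (mulr_ge0 Kl0).
have S2 : `|psi t0| <= 2 * `|psi 1|.
  have h1 := bound _ t001.
  have h2 : K * l * `|psi t0| <= 1 / 2 * `|psi t0| by rewrite ler_wpM2r.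
  have h3 := ler_normB (psi 1) (psi 1 - psi t0); rewrite subKr in h3.
  lra.
have b0 : `|psi 1 - psi 0| <= K * l * `|psi t0| by apply: bound; rewrite lexx ler01.
by rewrite distrC (le_trans b0)// [2 * (K * l)]mulrC -[leRHS]mulrA (ler_wpM2l Kl0).
Qed.

Lemma transport_close C xs w : M xs -> cdom C xs -> tangent M xs w ->
  rnorm g xs w = 1 -> forall e : R, 0 < e -> exists2 d : R, 0 < d &
    forall y v, M y -> `|y - xs| < d -> dist_star m M g sigma y xs v w < d ->
      cdom C y /\ `|dchart C y v - dchart C xs w| < e.
Proof.
move=> Mxs Cxs tw nw e e0; set u0 := cmap C xs.
have Cu0 : crange C u0 by exact: crange_cmap.
have [r1 [c1 [c2 [r10 c10 c20 H1]]]] := metric_bounds hg Cu0.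
have [r2 [K [r20 K0 H2]]] := chris_bounds hg Cu0.
have [r3 [k [r30 k0 H3]]] := dist_chart_le Cu0.
pose r := Num.min r1 r2; have r0 : 0 < r by rewrite lt_min r10.
have Hr (v : 'rV[R]_m) : `|v - u0| < r -> [/\ crange C v,
     forall a, c1 * `|a| <= rnorm g (cinv C v) ('d (cinv C) v a) &
     forall X Y, `|chris g C v X Y| <= K * `|X| * `|Y|].
  rewrite lt_min => /andP[v1 v2]; have [Cv Hv] := H1 _ v1; split=> //.
    by move=> a; have /andP[] := Hv a.
  by move=> X Y; have [] := H2 v v X Y v2 v2.
(* Bound for the coordinates of the transported vector at [xs]: it differs from [w] by less than 1
   in the metric, hence by at most 1 / c1 in coordinates. *)
pose X := `|dchart C xs w| + 1 / c1.
have X0 : 0 <= X by rewrite addr_ge0// divr_ge0// ltW.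
pose A := k / c1; have A0 : 0 <= A by rewrite divr_ge0// ltW.
(* In order: the bound on [dist] applies; the geodesic, whose length divided by [c1] is at most A |u
   - u0|, stays within r / 2; the smallness condition of [parallel_close] holds; its error is below
   e / 2. *)
pose eta := Num.min (Num.min r3 (r / 2 / (1 + A)))
   (Num.min (1 / 2 / (K * A + 1)) (e / 2 / (2 * (K * A) * X + 1))).
have A1 : 0 < 1 + A by rewrite ltr_pwDl.
have KA0 : 0 <= K * A by rewrite mulr_ge0.
have KAX0 : 0 <= 2 * (K * A) * X by rewrite (mulr_ge0 _ X0)// mulr_ge0.
have KA1 : 0 < K * A + 1 by rewrite ltr_wpDl.
have KAX1 : 0 < 2 * (K * A) * X + 1 by rewrite ltr_wpDl.
have eta0 : 0 < eta by rewrite !lt_min r30 !divr_gt0.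
have [d1 d10 Hd1] := cmap_eps Mxs Cxs eta0.
(* The bound 1 excludes the default value of [ptransport] and justifies [X]; the last bound makes
   the discrepancy with [w] less than e / 2 in coordinates. *)
pose d := Num.min d1 (Num.min 1 (e / 2 * c1)).
have d0 : 0 < d by rewrite !lt_min d10 ltr01 mulr_gt0// divr_gt0.
exists d => // y v My; rewrite lt_min => /andP[yd1 _].
rewrite !lt_min => /and3P[_ ds1 dse].
have [Cy yeta] := Hd1 _ My yd1; split=> //.
move: yeta; set u := cmap C y; rewrite !lt_min => /andP[/andP[ur3 ur] /andP[uK ue]].
set c := sigma y xs.
have [[[gc c0 c1xs] _] _] := (hsigma.1 y xs My Mxs, tt).
rewrite -/c in gc c0 c1xs.
have Eu : cinv C u = y by rewrite cmapK.
have Eu0 : cinv C u0 = xs by rewrite cmapK.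
have u0r3 : `|u0 - u0| < r3 by rewrite subrr normr0.
have [_ _ ] := H3 _ _ ur3 u0r3; rewrite Eu Eu0 /dist -/c => lk.
set l := curve_length g c in lk.
have l0 : 0 <= l by exact: (curve_length_ge0 hg gc).
have lA : l / c1 <= A * `|u - u0|.
  by rewrite ler_pdivrMr// (le_trans lk)// /A mulrAC divfK// gt_eqF.
have nu0 : 0 <= `|u - u0| by exact: normr_ge0.
have KlA : K * (l / c1) <= K * A * `|u - u0| by rewrite -mulrA ler_wpM2l.
have cond1 : `|u - u0| + l / c1 <= r / 2.
  by move: ur; rewrite ltr_pdivlMr// => ur; lra.
have cond2 : K * (l / c1) <= 1 / 2.
  by move: uK; rewrite ltr_pdivlMr// => uK; lra.
have [[V [pV V0 V1]]|noV] := pselect (exists V, [/\ parallel m M g c V, V 0 = v &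
    V 1 = ptransport m M g sigma y xs v]); last first.
  exfalso; move: ds1; rewrite /dist_star.
  suff -> : ptransport m M g sigma y xs v = 0 by rewrite subr0 nw ltxx.
  rewrite /ptransport; case: xgetP => // w' w'E [V [pV V0 V1]].
  by exfalso; apply: noV; exists V; split=> //; rewrite V1 /ptransport w'E.
set w' := ptransport m M g sigma y xs v in V1.
have i01 : (0 : R) <= (1 : R) <= (1 : R) by rewrite ler01 lexx.
have tw' : tangent M xs w'.
  have := pV 1 i01 C; rewrite c1xs => /(_ Cxs)[/nbhs_singleton[_ _ _]].
  by rewrite V1 c1xs.
have rr2 : r / 2 < r by rewrite gtr_pMr// invf_lt1// ltr1n.
have c0u : c 0 = cinv C u by rewrite Eu.
have := parallel_close c10 rr2 K0 Hr gc c0u cond1 pV cond2.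
rewrite /coordV c0 c1xs V0 V1 -/l => close.
have wdist : `|dchart C xs w - dchart C xs w'| <= dist_star m M g sigma y xs v w / c1.
  rewrite -dchartB// ler_pdivlMr// mulrC.
  have u0r1 : `|u0 - u0| < r by rewrite subrr normr0.
  have [_ /(_ (dchart C xs (w - w'))) + _] := Hr _ u0r1.
  rewrite dchartK// ?Eu0//.
  apply/(tangentP _ Mxs Cxs); exists (dchart C xs w - dchart C xs w').
  by rewrite linearB/= !dchartK.
set ds := dist_star _ _ _ _ _ _ _ _ in ds1 dse wdist.
have dsc : ds / c1 <= 1 / c1 by rewrite ler_wpM2r ?invr_ge0 ?(ltW c10) ?(ltW ds1).
have dse2 : ds / c1 < e / 2 by rewrite ltr_pdivrMr.
have wX : `|dchart C xs w'| <= X.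
  have := ler_normB (dchart C xs w) (dchart C xs w - dchart C xs w').
  by rewrite subKr /X; lra.
have Kl0 : 0 <= K * (l / c1) by rewrite mulr_ge0// divr_ge0// ltW.
have close2 : 2 * (K * (l / c1)) * `|dchart C xs w'| <= 2 * (K * A * `|u - u0|) * X.
  apply: ler_pM; [exact: mulr_ge0|exact: normr_ge0|exact: ler_wpM2l|exact: wX].
have ue2 : `|u - u0| * (2 * (K * A) * X + 1) < e / 2 by rewrite -ltr_pdivlMr.
have := ler_distD (dchart C xs w') (dchart C y v) (dchart C xs w).
rewrite [`|dchart C xs w' - _|]distrC => tri.
rewrite (le_lt_trans tri)//; lra.
Qed.

End ShortestGeodesics.

(** * The line search *)

(** The value on exit is rejected, and if the loop body is entered the preceding value [b / gamma2]
    was accepted. The clause [b = a] lets the induction tell immediate rejection of the next value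
    from further acceptance. *)
Lemma ls_loopP (R : realType) (n : nat) (f : 'rV[R]_n -> R)
    (Ret : 'rV[R]_n -> 'rV[R]_n -> 'rV[R]_n) (gamma gamma2 : R) (x d : 'rV[R]_n)
    (a b : R) : 1 <= gamma2 -> ls_loop f Ret gamma gamma2 x d a b -> 0 < a ->
  [/\ f x - gamma * b ^+ 2 < f (Ret x (b *: d)),
      f x - gamma * a ^+ 2 < f (Ret x (a *: d)) -> b = a &
      f (Ret x (a *: d)) <= f x - gamma * a ^+ 2 ->
      a <= b / gamma2 /\
      f (Ret x ((b / gamma2) *: d)) <= f x - gamma * (b / gamma2) ^+ 2].
Proof.
move=> g1; have g0 : 0 < gamma2 by exact: lt_le_trans g1.
elim=> {a b} [a fa a0|a b sa lab IH a0].
  by split=> // sa; move: (le_lt_trans sa fa); rewrite ltxx.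
have [|fb E S] := IH; first by rewrite mulr_gt0.
split=> // [fa|_]; first by move: (le_lt_trans sa fa); rewrite ltxx.
have [s|fl] := leP (f (Ret x ((gamma2 * a) *: d))) (f x - gamma * (gamma2 * a) ^+ 2).
  have [h1 h2] := S s; split=> //.
  by rewrite (le_trans _ h1)// ler_peMl// ltW.
have Eb : b / gamma2 = a by rewrite (E fl) mulrC mulKf// gt_eqF.
by rewrite Eb.
Qed.

Lemma linesearchP (R : realType) (n : nat) (f : 'rV[R]_n -> R)
    (Ret : 'rV[R]_n -> 'rV[R]_n -> 'rV[R]_n) (gamma gamma1 gamma2 : R)
    (x d : 'rV[R]_n) (a : R) (r : R * R) :
  linesearch f Ret gamma gamma1 gamma2 x d a r ->
  (f x - gamma * a ^+ 2 < f (Ret x (a *: d)) /\ r = (0, gamma1 * a)) \/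
  exists b, [/\ f (Ret x (a *: d)) <= f x - gamma * a ^+ 2,
    ls_loop f Ret gamma gamma2 x d a b & r = (b / gamma2, b / gamma2)].
Proof. by case=> [fl|b sa lab]; [left|right; exists b]. Qed.

(** Meant for the trial stepsizes: a failure multiplies by [gamma1], a success copies the accepted
    step, which is eventually small. Once below [e] the sequence remains there, and if it never got
    there it would decay geometrically. *)
Lemma eventually_geometric (R : realType) (gam e : R) (a : nat -> R) :
  0 < gam < 1 -> 0 < e -> (forall k, a k.+1 < e \/ a k.+1 = gam * a k) ->
  exists N, forall k, (N <= k)%N -> a k < e.
Proof.
move=> /andP[g0 g1] e0 Ha.
have Hb k : a k < e -> a k.+1 < e.
  move=> ak; have [//|->] := Ha k.
  have [ak0|ak0] := leP 0 (a k); first by rewrite (le_lt_trans _ ak)// ler_piMl// ltW.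
  by rewrite (lt_trans _ e0)// pmulr_rlt0.
suff [N HN] : exists N, a N < e.
  exists N => k Nk; rewrite -(subnK Nk).
  by elim: (k - N)%N => [|j IH]; rewrite ?add0n// addSn; exact: Hb.
apply: contrapT => nN.
have all k : e <= a k by rewrite leNgt; apply/negP => h; apply: nN; exists k.
have aE k : a k = a 0%N * gam ^+ k.
  elim: k => [|k IH]; first by rewrite expr0 mulr1.
  have [h|->] := Ha k; last by rewrite IH exprS mulrCA.
  by have := all k.+1; rewrite leNgt h.
have : geometric (a 0%N) gam @ \oo --> (0 : R).
  by apply: cvg_geometric; rewrite ger0_norm// ltW.
move=> /cvgrPdist_lt/(_ e e0)[k _ /(_ k (leqnn _))]; rewrite sub0r normrN /= => Hk.
by have := all k; rewrite leNgt aE (le_lt_trans _ Hk)// ler_norm.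
Qed.

Lemma nonincreasing_gap (R : realType) (F a : nat -> R) (b : R) :
  (forall k, b <= F k) -> (forall k, 0 <= a k) -> (forall k, F k.+1 <= F k - a k) ->
  forall e : R, 0 < e -> exists N, forall k, (N <= k)%N -> a k < e.
Proof.
move=> bF a0 FF e e0.
have cF : cvgn F.
  apply: nonincreasing_is_cvgn; last by exists b => _ [k _ <-].
  by apply/nonincreasing_seqP => k; rewrite (le_trans (FF k))// gerBl.
have /cvgrPdist_lt/(_ _ (_ : 0 < e / 2)) : F k @[k --> \oo] --> lim (F k @[k --> \oo]) by [].
rewrite divr_gt0// => /(_ isT)[N _ HN]; exists N => k Nk.
have := HN k Nk; have := HN k.+1 (leqW Nk); rewrite !ltr_norml => /andP[] ? ? /andP[] ? ?.
have := FF k; lra.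
Qed.

Section RunOfAlgorithm.
Context {R : realType} {n m : nat} (M : set 'rV[R]_n).
Context (g : 'rV[R]_n -> 'rV[R]_n -> 'rV[R]_n -> R).
Context (f : 'rV[R]_n -> R) (Ret : 'rV[R]_n -> 'rV[R]_n -> 'rV[R]_n).
Context (gamma gamma1 gamma2 : R) (dbar x d : nat -> 'rV[R]_n) (alpha alphat : nat -> R).
Hypothesis hM : embedded_submanifold m M.
Hypothesis hfb : bounded_below_on_manifold M f.
Hypothesis hR : C1_retraction m M Ret.
Hypothesis hx : rdse_dd M g f Ret gamma gamma1 gamma2 dbar x d alpha alphat.

Lemma run_tangent k : M (x k) /\ tangent M (x k) (d k).
Proof.
have [[Mx0 _ _ _ _] _ dE _ xE] := hx; have [RM _ _ _] := hR.
have td j : M (x j) -> tangent M (x j) (d j).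
  move=> Mj; have [C Cj] := hM Mj; rewrite dE /=; case: eqP => _.
    exact: tangent0 Mj Cj.
  (* The default value of [tproj] is 0, which is tangent as well. *)
  apply: (tangentZ _ Mj Cj); rewrite /tproj; case: xgetP => [p -> []//|_].
  exact: tangent0 Mj Cj.
suff Mk : M (x k) by split=> //; exact: td.
elim: k => // k Mk; rewrite xE; have [C Ck] := hM Mk; apply: RM => //.
by apply: (tangentZ _ Mk Ck); exact: td.
Qed.

(** The rejected stepsize [beta] is [alphat k] when the search fails, and the exit value of the
    loop, [gamma2 * alpha k], when it succeeds. The common bound makes it vanish along with both
    stepsizes. *)
Lemma run_step k : 0 < alphat k ->
  [/\ 0 < alphat k.+1, 0 <= alpha k, f (x k.+1) <= f (x k) - gamma * alpha k ^+ 2,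
      alphat k.+1 = gamma1 * alphat k \/ alphat k.+1 = alpha k &
      exists beta : R, [/\ 0 < beta, beta <= gamma2 * (alphat k + alpha k) &
        f (x k) - gamma * beta ^+ 2 < f (Ret (x k) (beta *: d k))]].
Proof.
move=> ak0; have [[_ _ gam0 /andP[g10 g11] g21] _ _ ls xE] := hx.
have g20 : 0 < gamma2 by exact: lt_le_trans g21.
have [Mk tk] := run_tangent k.
have [_ _ R0 _] := hR.
have [[fl [Ea Et]]|[b [sa lab [Ea Et]]]] := linesearchP (ls k); rewrite Et Ea.
  split=> //; first by rewrite mulr_gt0.
  - by rewrite xE Ea scale0r R0// expr0n mulr0 subr0.
  - by left.
  - exists (alphat k); split=> //.
    by rewrite addr0 ler_peMl// ltW.
have [fb _ /(_ sa)[ab sb]] := ls_loopP g21 lab ak0.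
have bg0 : 0 < b / gamma2 by exact: lt_le_trans ab.
split=> //.
- exact: ltW.
- by rewrite xE Ea.
- by right.
- exists b; split=> //; first by rewrite -(divfK (lt0r_neq0 g20) b) mulr_gt0.
  rewrite mulrDr [gamma2 * (b / _)]mulrC divfK ?lt0r_neq0// lerDr.
  by rewrite mulr_ge0// ltW.
Qed.

Lemma run_unsuccessful_steps : exists beta : nat -> R, [/\ forall k, 0 < beta k,
  forall k, f (x k) - gamma * beta k ^+ 2 < f (Ret (x k) (beta k *: d k)) &
  forall e : R, 0 < e -> exists N, forall k, (N <= k)%N -> beta k < e].
Proof.
have [[_ a00 gam0 g1 g21] _ _ ls xE] := hx.
have at0 k : 0 < alphat k by elim: k => // k /run_step[].
have step k := run_step (at0 k).
have g20 : 0 < gamma2 by exact: lt_le_trans g21.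
have [b bP] := hfb.
have al0 : forall e : R, 0 < e -> exists N, forall k, (N <= k)%N -> alpha k < e.
  move=> e e0; have ge0 : 0 < gamma * e ^+ 2 by rewrite mulr_gt0// exprn_gt0.
  have [|||N HN] := @nonincreasing_gap R (f \o x)
    (fun k => gamma * alpha k ^+ 2) b _ _ _ _ ge0.
  - by move=> k; apply: bP; have [] := run_tangent k.
  - by move=> k; rewrite mulr_ge0 ?exprn_ge0 ?(ltW gam0)//; have [] := step k.
  - by move=> k /=; have [] := step k.
  exists N => k /HN; rewrite ltr_pM2l// ltr_pXn2r// nnegrE ?(ltW e0)//.
  by have [] := step k.
have alt0 : forall e : R, 0 < e -> exists N, forall k, (N <= k)%N -> alphat k < e.
  move=> e e0; have [N HN] := al0 e e0.
  have [|N' HN'] := @eventually_geometric R gamma1 e (fun k => alphat (N + k)%N) g1 e0.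
    move=> k; rewrite addnS; have [_ _ _ [->|->] _] := step (N + k)%N; first by right.
    by left; apply: HN; rewrite leq_addr.
  exists (N + N')%N => k Nk.
  rewrite -(subnKC (leq_trans (leq_addr N' N) Nk)); apply: HN'.
  by rewrite leq_subRL// (leq_trans (leq_addr N' N) Nk).
have [beta betaP] := choice (fun k => let: And5 _ _ _ _ h := step k in h).
exists beta; split=> [k|k|e e0]; [by have [] := betaP k|by have [] := betaP k|].
have e2 : 0 < e / 2 / gamma2 by rewrite !divr_gt0.
have [N HN] := al0 _ e2; have [N' HN'] := alt0 _ e2.
exists (maxn N N') => k; rewrite geq_max => /andP[/HN h /HN' h'].
have [_ bk _] := betaP k; rewrite (le_lt_trans bk)// mulrC -ltr_pdivlMr//.
by rewrite (splitr e) mulrDl ltrD.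
Qed.

End RunOfAlgorithm.

(** * The retraction in a chart *)

Lemma derive_vertical (R : realType) (U V W : normedModType R) (E : U * V -> W)
    (u : U) (e : V) : 'D_(0, e) E (u, 0) = 'D_e (fun b => E (u, b)) 0.
Proof.
rewrite /derive; set F := (X in lim (X @ _)); set G := (X in _ = lim (X @ _)).
suff -> : F = G by [].
apply/funext => h; rewrite /F /G /=; congr (_ *: (E _ - _)).
by congr pair; rewrite /= scaler0 add0r.
Qed.

Section RetractionInChart.
Context {R : realType} {n m : nat} {M : set 'rV[R]_n}.
Context (Ret : 'rV[R]_n -> 'rV[R]_n -> 'rV[R]_n).
Hypothesis hR : C1_retraction m M Ret.
Implicit Types (C : chart m M).

Let vertical (i : 'I_m) : 'rV[R]_m * 'rV[R]_m := (0, delta_mx 0 i).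

Lemma vertical_sum (a : 'rV[R]_m) : \sum_i a 0 i *: vertical i = (0, a).
Proof.
rewrite [in RHS](row_sum_delta a).
elim: (index_enum _) => [|i s IH]; first by rewrite !big_nil.
rewrite !big_cons IH; congr pair; rewrite /= ?scaler0 ?addr0//.
Qed.

Lemma retraction_expansion C xs : M xs -> cdom C xs ->
  forall e : R, 0 < e -> exists2 d : R, 0 < d & forall y v, M y -> `|y - xs| < d ->
    tangent M y v -> `|dchart C y v| < d ->
    [/\ cdom C y, cdom C (Ret y v) &
      `|cmap C (Ret y v) - cmap C y - dchart C y v| <= e * `|dchart C y v| ].
Proof.
move=> Mxs Cxs e e0; have [RM /(_ C)[dE cE] R0 Rd] := hR.
set u0 := cmap C xs; have Cu0 : crange C u0 by exact: crange_cmap.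
have Eu0 : cinv C u0 = xs by rewrite cmapK.
pose E (p : 'rV[R]_m * 'rV[R]_m) := Ret (cinv C p.1) ('d (cinv C) (p.1) (p.2)).
have [B B0 HB] := immersion_lower_bound (cinv_dinj Cu0).
(* At (u0, 0) the normalization of the retraction identifies its fibre derivatives with the
   derivatives of [cinv]. *)
have dE0 (a : 'rV[R]_m) :
    \sum_i a 0 i *: 'D_(vertical i) E (u0, 0) = 'd (cinv C) u0 a.
  rewrite diff_sum_coord; last exact: cinv_diff.
  apply: eq_bigr => i _; congr (_ *: _).
  pose Phi (b : 'rV[R]_m) := E (u0, b).
  have dPhi : differentiable Phi 0.
    apply: (@differentiable_comp _ _ _ _ (fun b : 'rV[R]_m => (u0, b)) E).
      by apply: differentiable_pair.
    exact: dE.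
  transitivity ('D_(delta_mx 0 i) Phi 0).
    exact: derive_vertical.
  rewrite deriveE// deriveE; last exact: cinv_diff.
  have PhiE : Phi = fun b => Ret xs ('d (cinv C) (cmap C xs) b).
    by apply/funext => b; rewrite /Phi /E /= Eu0.
  by rewrite PhiE; exact: Rd.
have nearE : \forall q \near ((u0, 0) : 'rV[R]_m * 'rV[R]_m), differentiable E q.
  have [r r0 Hr] := (@near_ballP R 'rV[R]_m _ _).1 (crange_near Cu0).
  apply/(@near_ballP R ('rV[R]_m * 'rV[R]_m)%type); exists r => // q.
  by rewrite prod_normE gt_max => /andP[/Hr Cq _]; exact: dE.
(* B eta <= 1/2 lets |z - u| be absorbed, giving |z - u| <= 3 |a|; then |a| + |z - u| <= 4 |a|,
   whence the requirement 4 B eta <= e. *)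
pose eta := Num.min (1 / 2 / B) (e / (4 * B)).
have eta0 : 0 < eta by rewrite lt_min !divr_gt0// mulr_gt0.
have etaB : B * eta <= 1 / 2.
  by rewrite mulrC -ler_pdivlMr// ge_min lexx.
have etae : 4 * B * eta <= e.
  by rewrite mulrC -ler_pdivlMr ?mulr_gt0// ge_min lexx orbT.
have [||d1 d10 H1] := @strict_diff R ('rV[R]_m * 'rV[R]_m)%type m n E (u0, 0) vertical
  nearE _ _ eta eta0.
- by move=> i; exact: cE.
- by move=> a; rewrite vertical_sum prod_normE/= normr0 ge_max normr_ge0 lexx.
have [|||d2 d20 H2] := @strict_diff R 'rV[R]_m m n (cinv C) u0 (delta_mx 0) _ _ _ eta eta0.
- by apply: filterS (crange_near Cu0) => v; exact: cinv_diff.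
- by move=> i; exact: cinv_derive_cont.
- by move=> a; rewrite -row_sum_delta.
have d220 : 0 < d2 / 2 by rewrite divr_gt0.
have [d3 d30 H3] := cmap_eps Mxs Cxs d220.
have cEx : {for ((u0, 0) : 'rV[R]_m * 'rV[R]_m), continuous E}.
  exact/differentiable_continuous/dE.
(* Continuity of [E] at (u0, 0) puts R(y, v) in the chart, close enough to [xs] for the expansion of
   [cinv]. *)
have [d4 d40 H4] := (continuous_atP _ _).1 cEx _ d30.
pose d5 := Num.min (Num.min d1 d2) d4.
have d50 : 0 < d5 by rewrite !lt_min d10 d20.
have [d6 d60 H6] := cmap_eps Mxs Cxs d50.
exists (Num.min d3 (Num.min d6 d5)); first by rewrite !lt_min d30 d60 d10 d20.
move=> y v My; rewrite !lt_min => /and3P[yd3 yd6 _] tv /and3P[_ _ /andP[/andP[ad1 ad2] ad4]].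
have [Cy] := H6 _ My yd6; set u := cmap C y; set a := dchart C y v in ad1 ad2 ad4 *.
rewrite !lt_min => /andP[/andP[ud1 ud2] ud4].
have Eu : cinv C u = y by rewrite cmapK.
have EE : E (u, a) = Ret y v by rewrite /E /= Eu /a dchartK.
have EE0 : E (u, 0) = y by rewrite /E /= Eu linear0 R0.
have E00 : E (u0, 0) = xs by rewrite /E /= Eu0 linear0 R0.
have MRet := RM _ _ My tv.
have Retd3 : `|Ret y v - xs| < d3.
  by rewrite -EE -E00; apply: H4; rewrite prod_normE/= subr0 gt_max ud4.
have [CRet zd2] := H3 _ MRet Retd3.
split=> //; set z := cmap C (Ret y v).
have Ez : cinv C z = Ret y v by rewrite cmapK.
have h1 := H1 (u, 0) a; rewrite vertical_sum dE0 in h1.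
have {h1} : `|Ret y v - y - 'd (cinv C) u0 a| <= eta * `|a|.
  have := h1 _ ad1; rewrite -[(u, 0) + (0, a)]/(u + 0, 0 + a) addr0 add0r EE EE0.
  by apply; rewrite prod_normE/= subrr normr0 gt_max ud1.
have ud2' : `|u - u0| < d2 by [].
have [_ ud22] := H3 _ My yd3.
have zud2 : `|z - u| < d2.
  rewrite (le_lt_trans (ler_distD u0 _ _))// (splitr d2) ltrD//.
  by rewrite distrC.
have := H2 u (z - u) ud2' zud2; rewrite -row_sum_delta.
have -> : \sum_i (z - u) 0 i *: 'D_(delta_mx 0 i) (cinv C) u0 = 'd (cinv C) u0 (z - u).
  by rewrite diff_sum_coord//; exact: cinv_diff.
rewrite [u + _]addrC subrK Ez Eu => h2 h1.
have h3 : `|'d (cinv C) u0 (z - u - a)| <= eta * `|a| + eta * `|z - u|.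
  rewrite linearB/= (le_trans (ler_distD (Ret y v - y) _ _))// addrC lerD//.
  by rewrite distrC.
have h4 : `|z - u - a| <= B * eta * (`|a| + `|z - u|).
  by rewrite (le_trans (HB _))// -mulrA (ler_wpM2l (ltW B0))// mulrDr.
have zu0 : 0 <= `|z - u| by exact: normr_ge0.
have a0 : 0 <= `|a| by exact: normr_ge0.
have h5 : `|z - u| <= `|a| + `|z - u - a|.
  by rewrite -{1}(subrK a (z - u)) addrC ler_normD.
have h6 : B * eta * (`|a| + `|z - u|) <= 1 / 2 * (`|a| + `|z - u|).
  by rewrite ler_wpM2r// addr_ge0.
have h7 : `|z - u| <= 3 * `|a| by lra.
have Beta0 : 0 <= B * eta by rewrite mulr_ge0 ?(ltW B0) ?(ltW eta0).
have h8 : B * eta * (`|a| + `|z - u|) <= B * eta * (4 * `|a|) by rewrite ler_wpM2l//; lra.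
have h9 : 4 * B * eta * `|a| <= e * `|a| by rewrite ler_wpM2r.
rewrite (le_trans h4)// (le_trans h8)// (le_trans _ h9)//.
by rewrite mulrCA !mulrA.
Qed.

End RetractionInChart.

(** * Clarke stationarity *)

(** The upper limit is an infimum of suprema over the sets of the filter, so each of these sets only
    has to contain, for every e > 0, a quotient at least -e. *)
Lemma clarke_ge0 (R : realType) (m : nat) (h : 'rV[R]_m -> R) (y w : 'rV[R]_m) :
  (forall e r : R, 0 < e -> 0 < r -> exists z t, [/\ `|z - y| < r, 0 < t < r &
     h z - e * t <= h (z + t *: w)]) ->
  (0 <= clarke h y w)%E.
Proof.
move=> H; rewrite /clarke limf_esupE; apply: le_ereal_inf_tmp => _ [V FV <-].
have [[A B] /= [nA nB] ABV] := FV.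
have [r1 r10 Hr1] := (@near_ballP R 'rV[R]_m _ _).1 nA.
have [r2 /= r20 Hr2] := nB.
have sup_ge e : 0 < e -> ((- e)%:E <= ereal_sup [set
    ((h (p.1 + p.2 *: w) - h p.1) / p.2)%:E | p in V])%E.
  move=> e0; have r0 : 0 < Num.min r1 r2 by rewrite lt_min r10.
  have [z [t [zy /andP[t0 tr] hzt]]] := H _ _ e0 r0.
  move: zy tr; rewrite !lt_min => /andP[zy _] /andP[_ tr].
  apply: le_ereal_sup_tmp; exists ((h (z + t *: w) - h z) / t)%:E.
    exists (z, t) => //; apply: ABV; split; first exact: Hr1.
    by apply: Hr2 => //=; rewrite sub0r normrN gtr0_norm.
  by rewrite lee_fin ler_pdivlMr// mulNr; lra.
case: (ereal_sup _) sup_ge => [s|//|] H'.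
- rewrite lee_fin; apply/ler_addgt0Pr => e e0.
  by have := H' e e0; rewrite lee_fin; lra.
- by have := H' 1 ltr01.
Qed.

(** The final estimate uses a single index at a time, so all that is kept of the nested subsequences
    is an arbitrarily late iterate close to the limit in both senses. *)
Lemma refining_steps (R : realType) (n m : nat) (M : set 'rV[R]_n)
    (g : 'rV[R]_n -> 'rV[R]_n -> 'rV[R]_n -> R)
    (sigma : 'rV[R]_n -> 'rV[R]_n -> R -> 'rV[R]_n) (x d : nat -> 'rV[R]_n)
    (i : nat -> nat) (xs w : 'rV[R]_n) :
  refining m M g sigma x d i xs -> tangent M xs w -> rnorm g xs w = 1 ->
  forall (r : R) (N : nat), 0 < r -> exists k, [/\ (N <= k)%N, `|x k - xs| < r &
    dist_star m M g sigma (x k) xs (d k) w < r].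
Proof.
move=> [hi _ _ href] tw nw r N r0.
have [j hj [xj dj]] := href w tw nw.
have /cvgrPdist_lt/(_ r r0)[N1 _ H1] := xj.
have /cvgrPdist_lt/(_ r r0)[N2 _ H2] := dj.
have inc (h : nat -> nat) : {homo h : a b / (a < b)%N} -> forall k, (k <= h k)%N.
  by move=> hh; elim=> // k /leq_ltn_trans; apply; exact: hh.
pose k := maxn N (maxn N1 N2).
exists (i (j k)); split.
- by rewrite (leq_trans (leq_maxl N (maxn N1 N2)))// (leq_trans (inc _ hj k))// inc.
- by rewrite distrC; apply: H1; rewrite /= !leq_max leqnn orbT.
- have := H2 k; rewrite /= !leq_max leqnn !orbT => /(_ isT).
  by rewrite sub0r normrN; apply: le_lt_trans; exact: ler_norm.
Qed.

Unset Implicit Arguments.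

Theorem theorem4p2 (R : realType) (n m : nat) (M : set 'rV[R]_n)
    (g : 'rV[R]_n -> 'rV[R]_n -> 'rV[R]_n -> R)
    (sigma : 'rV[R]_n -> 'rV[R]_n -> R -> 'rV[R]_n)
    (f : 'rV[R]_n -> R) (Ret : 'rV[R]_n -> 'rV[R]_n -> 'rV[R]_n)
    (gamma gamma1 gamma2 : R) (dbar x d : nat -> 'rV[R]_n)
    (alpha alphat : nat -> R) (i : nat -> nat) (xs : 'rV[R]_n)
    (hM : embedded_submanifold m M)
    (hg : riemannian_metric m M g)
    (hsigma : shortest_geodesics m M g sigma)
    (hf : lipschitz_on_manifold M g sigma f)
    (hfb : bounded_below_on_manifold M f)
    (hR : C1_retraction m M Ret)
    (hRb : retraction_bounded M g sigma Ret)
    (hx : rdse_dd M g f Ret gamma gamma1 gamma2 dbar x d alpha alphat)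
    (hi : refining m M g sigma x d i xs) :
  clarke_stationary m M f xs.
Proof.
move=> C Cxs v tv; have [_ Mxs _ _] := hi; apply: clarke_ge0 => e r e0 r0.
set u0 := cmap C xs; have Cu0 : crange C u0 by exact: crange_cmap.
have Eu0 : cinv C u0 = xs by rewrite cmapK.
have [[_ _ gam0 _ _] _ _ _ _] := hx.
(* The zero direction cannot be normalized to a unit vector, but its quotients are 0. *)
have [v0|v0] := eqVneq v 0.
  have r20 : 0 < r / 2 by rewrite divr_gt0.
  exists u0, (r / 2); split; first by rewrite subrr normr0.
    by rewrite r20 gtr_pMr// invf_lt1// ltr1n.
  rewrite v0 -[X in dchart C xs X](linear0 ('d (cinv C) u0)) dchart_d//.
  by rewrite scaler0 addr0 gerBl mulr_ge0// ltW.
pose nu := rnorm g xs v.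
have nu0 : 0 < nu by rewrite sqrtr_gt0; have [_ _ gp _] := hg; exact: gp.
pose w := nu^-1 *: v; pose b := dchart C xs w.
have tw : tangent M xs w by exact: tangentZ Mxs Cxs tv.
have vb : dchart C xs v = nu *: b.
  by rewrite /b /w dchartZ// scalerA mulfV ?scale1r// gt_eqF.
have nw : rnorm g xs w = 1.
  rewrite /rnorm (metric_chartE hg Mxs Cxs tw tw) dchartZ// gformZ.
  rewrite -(metric_chartE hg Mxs Cxs tv tv) sqrtrM ?sqr_ge0// sqrtr_sqr.
  by rewrite ger0_norm ?invr_ge0 ?(ltW nu0)// mulVf// gt_eqF.
have [rf [L [rf0 L0 HL]]] := lipschitz_chart hg hsigma hf Cu0.
have [beta [beta0 fbeta betalim]] := run_unsuccessful_steps hM hfb hR hx.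
pose B := `|b| + 1.
have B0 : 0 < B by rewrite ltr_wpDl.
(* The loss [gamma t + L (eta B + eta)] per unit step must not exceed [e / nu]. *)
pose eta := Num.min 1 (e / nu / 2 / (L * (B + 1) + 1)).
have LB0 : 0 < L * (B + 1) + 1.
  by rewrite ltr_wpDl// mulr_ge0// addr_ge0// ltW.
have eta0 : 0 < eta by rewrite lt_min ltr01 !divr_gt0.
have etae : eta * (L * (B + 1) + 1) <= e / nu / 2.
  by rewrite -ler_pdivlMr// ge_min lexx orbT.
have eta1 : eta <= 1 by rewrite ge_min lexx.
have [d1 d10 H1] := retraction_expansion hR Mxs Cxs eta0.
have [d2 d20 H2] := transport_close hg hsigma Mxs Cxs tw nw eta0.
pose rr := Num.min r rf; have rr0 : 0 < rr by rewrite lt_min r0.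
have rr20 : 0 < rr / 2 by rewrite divr_gt0.
have [d3 d30 H3] := cmap_eps Mxs Cxs rr20.
(* In order, for t < tau: t / nu < r; the scaled direction is in the range of the retraction
   expansion; gamma t <= e / (2 nu); points within 2 B t of [y] stay in the Lipschitz ball. *)
pose tau := Num.min (r * nu) (Num.min (d1 / B)
  (Num.min (e / nu / 2 / gamma) (rr / 2 / (2 * B)))).
have tau0 : 0 < tau by rewrite !lt_min !divr_gt0 ?mulr_gt0.
have [N HN] := betalim _ tau0.
have delta0 : 0 < Num.min d1 (Num.min d2 d3) by rewrite !lt_min d10 d20.
have [k [Nk]] := refining_steps hi tw nw N delta0.
rewrite !lt_min => /and3P[xd1 xd2 xd3] /and3P[_ sd2 _].
have := HN _ Nk; set t := beta k; have t0 : 0 < t by exact: beta0.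
rewrite !lt_min => /and4P[tr td1 tgam trr].
have [Mk tk] := run_tangent hM hR hx k.
have [Ck ykr] := H3 _ Mk xd3; set y := cmap C (x k) in ykr.
have [_ wkb] := H2 _ _ Mk xd2 sd2; set wk := dchart C (x k) (d k) in wkb.
have wkB : `|wk| <= B.
  by rewrite -(subrK b wk) (le_trans (ler_normD _ _))// addrC lerD2l (le_trans (ltW wkb)).
have ttk : tangent M (x k) (t *: d k) by exact: tangentZ Mk Ck tk.
have twk : dchart C (x k) (t *: d k) = t *: wk by rewrite dchartZ.
have ntwk : `|t *: wk| <= t * B.
  by rewrite normrZ gtr0_norm// ler_wpM2l// ltW.
have [|_ CR zy] := H1 _ _ Mk xd1 ttk.
  by rewrite twk (le_lt_trans ntwk)// -ltr_pdivlMr.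
have MR : M (Ret (x k) (t *: d k)) by have [RM _ _ _] := hR; exact: RM.
set z := cmap C (Ret (x k) (t *: d k)) in zy.
move: zy; rewrite twk -/y => zy.
have Ez : cinv C z = Ret (x k) (t *: d k) by rewrite cmapK.
have Ey : cinv C y = x k by rewrite cmapK.
(* One error comes from the retraction, relative to |t wk| <= t B, the other from replacing the
   direction [wk] by [b]. *)
have zyb : `|z - (y + t *: b)| <= t * (eta * (B + 1)).
  have -> : z - (y + t *: b) = (z - y - t *: wk) + t *: (wk - b).
    by rewrite scalerBr addrA subrK opprD addrA.
  rewrite (le_trans (ler_normD _ _))// mulrDr mulr1 mulrDr lerD//.
    by rewrite (le_trans zy)// mulrCA ler_wpM2l// ltW.
  by rewrite normrZ gtr0_norm// ler_wpM2l// ltW.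
have tB : t * (2 * B) < rr / 2 by rewrite -ltr_pdivlMr// mulr_gt0.
have near_u0 (p : 'rV[R]_m) : `|p - y| <= t * (2 * B) -> `|p - u0| < rf.
  move=> py; have := ler_distD y p u0.
  have : rr <= rf by rewrite ge_min lexx orbT.
  lra.
have t_ge0 := ltW t0.
have B1 : 1 <= B by rewrite lerDr.
have yb_near : `|y + t *: b - u0| < rf.
  apply: near_u0; rewrite addrC addKr normrZ gtr0_norm// ler_wpM2l//.
  by rewrite /B; have := normr_ge0 b; lra.
have z_near : `|z - u0| < rf.
  apply: near_u0; rewrite -(subrK (t *: wk) (z - y)) (le_trans (ler_normD _ _))//.
  have h1 : eta * `|t *: wk| <= 1 * `|t *: wk| by rewrite ler_wpM2r.
  have -> : t * (2 * B) = t * B + t * B by ring.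
  by rewrite lerD// (le_trans zy)// (le_trans h1)// mul1r.
have := HL _ _ z_near yb_near; rewrite /= Ez => fz.
have decr := fbeta k; rewrite -/t in decr.
(* [v] has coordinates [nu *: b], so this step moves by [t *: b], the displacement compared with
   [z]. *)
exists y, (t / nu); split.
- by rewrite (lt_le_trans ykr)// (@le_trans _ _ rr)//; [lra|rewrite ge_min lexx].
- by rewrite divr_gt0//= ltr_pdivrMr.
rewrite vb scalerA divfK ?gt_eqF// Ey.
have fz2 : f (Ret (x k) (t *: d k)) - f (cinv C (y + t *: b)) <=
    t * (e / nu / 2 ).
  rewrite (le_trans (ler_norm _))// (le_trans fz)//.
  rewrite (@le_trans _ _ (L * (t * (eta * (B + 1)))))//; first by rewrite ler_wpM2l.
  rewrite mulrCA ler_wpM2l// (le_trans _ etae)// mulrCA ler_wpM2l ?(ltW eta0)//.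
  by rewrite lerDl.
have gt2 : gamma * t ^+ 2 <= t * (e / nu / 2).
  rewrite expr2 mulrCA ler_wpM2l//.
  by move: tgam; rewrite ltr_pdivlMr// mulrC => /ltW.
have -> : e * (t / nu) = t * (e / nu / 2) + t * (e / nu / 2) by field; rewrite gt_eqF.
rewrite /=; move: gt2 fz2 decr; clear.
move: (gamma * _) (t * _) (f _) (f _) (f _) => p1 p2 p3 p4 p5; lra.
Qed.
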